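(* Let $(W,S)$ and $(U,T)$ be Coxeter systems and let $(\phi,e)$ be a Juyumaya map between them, so $\phi\colon W\to U$ is a group homomorphism and $e\colon S\to\Sigma(\Phi_U)$ is a map. Let $R$ be a commutative ring with trivial $W$-action, and let $u\colon S\to R^\times$, $s\mapsto u_s$, be a $W$-equivariant map. Let $\rho_\phi$ be the $W$-action on $\Sigma(\Phi_U)$ induced by $\phi$ and by the canonical action of $U$ on $\Phi_U$. Then: (1) $(\Sigma(\Phi_U)_{[e]},\rho_\phi,e)$ is a Marin-Iwahori-Hecke monoid (for $(W,S)$). (2) Consequently, $\mathcal{E}^{(W,S)}(R[\Sigma(\Phi_U)_{[e]}],\rho_\phi,\hat e)$ is a free $R[\Sigma(\Phi_U)_{[e]}]$-module with basis $\{g_w\mid w\in W\}$, where $\hat e_s=1+(u_s-1)e_s$ for $s\in S$. (3) The augmentation map $\epsilon\colon R[\Sigma(\Phi_U)_{[e]}]\to R$ (the $R$-linear map sending every element of the monoid to $1$) induces a surjective algebra homomorphism $$\mathcal{E}^{(W,S)}(R[\Sigma(\Phi_U)_{[e]}],\rho_\phi,\hat e)\to H_R(W,S)(u_s)$$ (equal to $\epsilon$ on $R[\Sigma(\Phi_U)_{[e]}]$ and sending $g_s\mapsto g_s$ for $s\in S$).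
   Context: Root subsystems. For a Coxeter system $(U,T)$, let $V_U$ be its standard geometric representation (real vector space with basis $\{\alpha_t\}_{t\in T}$, symmetric bilinear form $B(\alpha_t,\alpha_{t'})=-\cos(\pi/m_{t,t'})$, equal to $-1$ if $m_{t,t'}=\infty$; $t$ acts by $v\mapsto v-2B(v,\alpha_t)\alpha_t$), and let $\Phi_U=\{u.\alpha_t\mid u\in U,t\in T\}$ be its root system. For $\beta\in\Phi_U$ let $\sigma_\beta(v)=v-2B(v,\beta)\beta$. A root subsystem of $\Phi_U$ is a (possibly empty) subset $\Psi\subseteq\Phi_U$ with $\sigma_\beta(\Psi)=\Psi$ for all $\beta\in\Psi$. $\Sigma(\Phi_U)$ is the set of root subsystems of $\Phi_U$; $\langle X\rangle$ is the root subsystem generated by $X$ (the smallest one containing $X$) and $\langle X,Y\rangle=\langle X\cup Y\rangle$. With the product $\Psi_1\cdot\Psi_2=\langle\Psi_1,\Psi_2\rangle$, $\Sigma(\Phi_U)$ is a commutative monoid in which every element is idempotent; $U$ acts on it by monoid automorphisms through its action on $\Phi_U$. Given a homomorphism $\phi\colon W\to U$, $W$ acts by $w.\Psi=\phi(w).\Psi$. $W$-equivariance. A map $f$ from $S$ to a $W$-set (or to a subset of it) is called $W$-equivariant if, for all $s_1,s_2\in S$ and $w\in W$ with $ws_1w^{-1}=s_2$, one has $w.f(s_1)=f(s_2)$. Juyumaya map. A pair $(\phi,e)$ with $\phi\colon W\to U$ a group homomorphism (not necessarily a morphism of Coxeter systems) and $e\colon S\to\Sigma(\Phi_U)$, $s\mapsto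 e_s$, a map which is $W$-equivariant (via $\phi$) and satisfies $\langle e_{s_1},w.e_{s_2}\rangle=\langle e_{s_1},(s_1w).e_{s_2}\rangle$ for all $s_1,s_2\in S$, $w\in W$. $\Sigma(\Phi_U)_{[e]}$ denotes the submonoid of $\Sigma(\Phi_U)$ generated by all the elements $w.e_s$ with $w\in W$, $s\in S$; it is $W$-stable. Marin-Iwahori-Hecke monoid. A triple $(E,\rho,e)$ with $E$ a commutative monoid, $\rho$ a $W$-action on $E$ by monoid automorphisms, and $e\colon S\to\mathrm{Idempotents}(E)$ a $W$-equivariant map such that $e_s\cdot x=e_s\cdot(s.x)$ for all $s\in S$, $x\in E$. Marin ring. Let $B_W$ be the Artin braid group of $(W,S)$, with generators $g_s$ ($s\in S$) and the braid relations of $(W,S)$, and let $\pi\colon B_W\to W$ be the canonical projection; for $w\in W$ with reduced expression $w=s_1\cdots s_k$ set $g_w=g_{s_1}\cdots g_{s_k}$ (independent of the reduced expression). For a commutative algebra $A$ over a commutative ring $k$, an action $\rho$ of $W$ on $A$ by $k$-algebra automorphisms, and a $W$-equivariant map $a\colon S\to A^\times$, the Marin ring $\mathcal{E}^{(W,S)}(A,\rho,a)$ is the quotient of the semidirect product $A\rtimes k[B_W]$ (generated by $A$ and $B_W$ with $gc=(\pi(g).c)g$ for $g\in B_W$, $c\in A$) by the two-sided ideal generated by the elements $g_s^2-a_s-(1-a_s)g_s$, $s\in S$. It is an $A$-module by left multiplication. Here it is used with $A=R[E]$, the monoid algebra of $E=\Sigma(\Phi_U)_{[e]}$, with the $R$-linearly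 extended $W$-action, over the ground ring $k=R$, and $a=\hat e$ ($\hat e_s$ is invertible with inverse $1+u_s^{-1}(1-u_s)e_s$). Iwahori–Hecke algebra. $H_R(W,S)(u_s)=\mathcal{E}^{(W,S)}(R,\rho_{\mathrm{triv}},u)$, i.e. the $R$-algebra generated by $g_s$, $s\in S$, with the braid relations of $(W,S)$ and $g_s^2=u_s+(1-u_s)g_s$. *)

(* Defs.v *)
From HB Require Import structures.
From mathcomp Require Import all_boot all_order all_algebra.
From mathcomp Require Import finmap generic_quotient.
From mathcomp Require Import boolp classical_sets reals trigo.
From mathcomp Require Import monalg ring.

Set Implicit Arguments.
Unset Strict Implicit.
Unset Printing Implicit Defensive.

Import Order.TTheory GRing.Theory Num.Theory.

Local Open Scope classical_set_scope.
Local Open Scope ring_scope.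

(* Groups given by generators and relations: the letters (x, true) and
   (x, false) of a word stand for x and x^-1. *)
Section Presentation.
Variable X : choiceType.

Definition word := seq (X * bool).

Inductive pres_eq (R : word -> word -> Prop) : word -> word -> Prop :=
| pres_rel w1 w2 : R w1 w2 -> pres_eq R w1 w2
| pres_cancel x b : pres_eq R [:: (x, b); (x, ~~ b)] [::]
| pres_cat w1 w1' w2 w2' : pres_eq R w1 w1' -> pres_eq R w2 w2' ->
    pres_eq R (w1 ++ w2) (w1' ++ w2')
| pres_refl w : pres_eq R w w
| pres_sym w1 w2 : pres_eq R w1 w2 -> pres_eq R w2 w1
| pres_trans w2 w1 w3 : pres_eq R w1 w2 -> pres_eq R w2 w3 ->
    pres_eq R w1 w3.

Definition word_inv (w : word) : word := rev [seq (l.1, ~~ l.2) | l <- w].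

Definition word_eval (G : groupType) (f : X -> G) (w : word) : G :=
  (\prod_(l <- w) (if l.2 then f l.1 else (f l.1)^-1))%g.

Variable rels : word -> word -> Prop.

Lemma word_inv_cat w1 w2 : word_inv (w1 ++ w2) = word_inv w2 ++ word_inv w1.
Proof. by rewrite /word_inv map_cat rev_cat. Qed.

Lemma word_invK : involutive word_inv.
Proof.
move=> w; rewrite /word_inv map_rev revK -map_comp -[RHS]map_id.
by apply: eq_map => -[x b] /=; rewrite negbK.
Qed.

Lemma pres_eqV w : pres_eq rels (word_inv w ++ w) [::].
Proof.
elim: w => [|[x b] w IHw]; first exact: pres_refl.
rewrite -cat1s word_inv_cat catA -(catA (word_inv w)) -[[::]]/([::] ++ [::]).
apply: pres_trans IHw; apply: pres_cat; last exact: pres_refl.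
rewrite -[X in pres_eq _ _ X]cats0; apply: pres_cat; first exact: pres_refl.
rewrite /word_inv/=; have := pres_cancel rels x (~~ b); by rewrite negbK.
Qed.

Lemma pres_eq_inv w1 w2 :
  pres_eq rels w1 w2 -> pres_eq rels (word_inv w1) (word_inv w2).
Proof.
move=> w12; apply: (@pres_trans _ (word_inv w1 ++ (w2 ++ word_inv w2))).
  rewrite -[X in pres_eq _ X _]cats0; apply: pres_cat (pres_refl _ _) _.
  apply: pres_sym; rewrite -[X in X ++ _]word_invK; exact: pres_eqV.
rewrite catA -[X in pres_eq _ _ X]cat0s; apply: pres_cat; last exact: pres_refl.
apply: pres_trans (pres_eqV w1).
by apply: pres_cat; [exact: pres_refl|exact: pres_sym].
Qed.

Definition pres_eqb : rel word := fun w1 w2 => `[< pres_eq rels w1 w2 >].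

Lemma pres_eqb_refl : reflexive pres_eqb.
Proof. by move=> w; apply/asboolP; exact: pres_refl. Qed.
Lemma pres_eqb_sym : symmetric pres_eqb.
Proof. by move=> v w; apply/asboolP/asboolP => /pres_sym. Qed.
Lemma pres_eqb_trans : transitive pres_eqb.
Proof.
by move=> w v x /asboolP vw /asboolP wx; apply/asboolP/(pres_trans vw wx).
Qed.

Canonical pres_equiv :=
  EquivRel pres_eqb pres_eqb_refl pres_eqb_sym pres_eqb_trans.

Definition presented := {eq_quot pres_eqb}%qT.
HB.instance Definition _ := EqQuotient.on presented.
HB.instance Definition _ := Choice.on presented.

Definition pres_class (w : word) : presented := (\pi_presented w)%qT.

Lemma pres_classP w1 w2 : pres_class w1 = pres_class w2 <-> pres_eq rels w1 w2.
Proof.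
split=> [/eqP|h]; first by rewrite /pres_class eqmodE => /asboolP.
by apply/eqP; rewrite /pres_class eqmodE; apply/asboolP.
Qed.

Lemma pres_reprK (q : presented) : pres_class (repr q) = q.
Proof. exact: reprK. Qed.

Lemma pres_repr w : pres_eq rels (repr (pres_class w)) w.
Proof. by apply/pres_classP; rewrite pres_reprK. Qed.

Definition pres_one := pres_class [::].
Definition pres_inv (q : presented) := pres_class (word_inv (repr q)).
Definition pres_mul (q r : presented) := pres_class (repr q ++ repr r).

Lemma pres_mulE w1 w2 :
  pres_mul (pres_class w1) (pres_class w2) = pres_class (w1 ++ w2).
Proof. by apply/pres_classP; apply: pres_cat; exact: pres_repr. Qed.

Lemma pres_invE w : pres_inv (pres_class w) = pres_class (word_inv w).
Proof. by apply/pres_classP; apply: pres_eq_inv; exact: pres_repr. Qed.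

Lemma pres_mulA : associative pres_mul.
Proof.
move=> p q r; rewrite -(pres_reprK p) -(pres_reprK q) -(pres_reprK r).
by rewrite !pres_mulE catA.
Qed.
Lemma pres_mul1 : left_id pres_one pres_mul.
Proof. by move=> p; rewrite -(pres_reprK p) pres_mulE. Qed.
Lemma pres_mulr1 : right_id pres_one pres_mul.
Proof. by move=> p; rewrite -(pres_reprK p) pres_mulE cats0. Qed.
Lemma pres_mulV : left_inverse pres_one pres_inv pres_mul.
Proof.
move=> p; rewrite -(pres_reprK p) pres_invE pres_mulE.
by apply/pres_classP/pres_eqV.
Qed.
Lemma pres_mulrV : right_inverse pres_one pres_inv pres_mul.
Proof.
move=> p; rewrite -(pres_reprK p) pres_invE pres_mulE.
by apply/pres_classP; rewrite -{1}[repr p]word_invK; exact: pres_eqV.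
Qed.

HB.instance Definition _ := isGroup.Build presented
  pres_mulA pres_mul1 pres_mulr1 pres_mulV pres_mulrV.

Lemma pres_classM w1 w2 :
  pres_class (w1 ++ w2) = (pres_class w1 * pres_class w2)%g.
Proof. by rewrite -pres_mulE. Qed.

Section Lift.
Variables (G : groupType) (f : X -> G).
Hypothesis f_rel : forall w1 w2, rels w1 w2 -> word_eval f w1 = word_eval f w2.

Lemma word_eval_cat w1 w2 :
  word_eval f (w1 ++ w2) = (word_eval f w1 * word_eval f w2)%g.
Proof. by rewrite /word_eval big_cat. Qed.

Lemma word_eval_pres w1 w2 : pres_eq rels w1 w2 -> word_eval f w1 = word_eval f w2.
Proof.
elim=> {w1 w2} [||w1 w1' w2 w2' _ IH1 _ IH2|//|w1 w2 _ -> //|w2 w1 w3 _ -> _ -> //].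
- exact: f_rel.
- move=> x [] /=; rewrite /word_eval !big_cons big_nil /= mulg1.
    by rewrite mulgV.
  by rewrite mulVg.
by rewrite !word_eval_cat IH1 IH2.
Qed.

Definition pres_lift (q : presented) : G := word_eval f (repr q).

Lemma pres_lift_class w : pres_lift (pres_class w) = word_eval f w.
Proof. exact/word_eval_pres/pres_repr. Qed.

Lemma pres_liftM : {morph pres_lift : q r / (q * r)%g}.
Proof.
move=> q r; rewrite -(pres_reprK q) -(pres_reprK r) -pres_classM.
by rewrite !pres_lift_class word_eval_cat.
Qed.

Lemma pres_lift1 : pres_lift 1%g = 1%g.
Proof. by rewrite pres_lift_class /word_eval big_nil. Qed.
End Lift.

End Presentation.

HB.mixin Record Monoid_isCommutative E of Monoid E := {
  commgC : forall x y : E, (x * y)%g = (y * x)%g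
}.
#[short(type="comMonoidType")]
HB.structure Definition ComMonoid := {E of Monoid_isCommutative E & Monoid E}.

Record monoid_action (G E : monoidType) := MonoidAction {
  mact :> G -> E -> E;
  mact1 : forall x, mact 1%g x = x;
  mactM : forall g h x, mact (g * h)%g x = mact g (mact h x);
  mact_one : forall g, mact g 1%g = 1%g;
  mact_mul : forall g x y, mact g (x * y)%g = (mact g x * mact g y)%g }.

Record ring_action (G : monoidType) (A : pzRingType) := RingAction {
  ract :> G -> A -> A;
  ract1 : forall a, ract 1%g a = a;
  ractM : forall g h a, ract (g * h)%g a = ract g (ract h a);
  ract_one : forall g, ract g 1 = 1;
  ract_add : forall g a b, ract g (a + b) = ract g a + ract g b;
  ract_mul : forall g a b, ract g (a * b) = ract g a * ract g b }.

Section TrivialAction.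
Variables (G : monoidType) (A : pzRingType).
Definition triv_action : ring_action G A :=
  @RingAction G A (fun _ a => a) (fun _ => erefl) (fun _ _ _ => erefl)
    (fun _ => erefl) (fun _ _ _ => erefl) (fun _ _ _ => erefl).
End TrivialAction.

Lemma ract0 G A (rho : ring_action G A) g : rho g 0 = 0.
Proof. by apply: (addIr (rho g 0)); rewrite -ract_add !add0r. Qed.

(* A finitely supported function f : K -> A is an element of {malg A[K]}, and
   << a *g k >> is the one with value a at k and 0 elsewhere. *)
Section MalgExt.
Variables (K : choiceType) (A : zmodType).

Definition malg_ext (Z : zmodType) (h : K -> A -> Z) (f : {malg A[K]}) : Z :=
  \sum_(k <- msupp f) h k f@_k.

Lemma malg_ind (P : {malg A[K]} -> Prop) :
  P 0 -> (forall k a, P << a *g k >>) ->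
  (forall f g, P f -> P g -> P (f + g)) -> forall f, P f.
Proof. by move=> P0 PU PD f; rewrite [f]monalgE; apply: big_ind. Qed.

Section Ext.
Variables (Z : zmodType) (h : K -> A -> Z).
Hypothesis hD : forall k a b, h k (a + b) = h k a + h k b.

Lemma malg_ext_h0 k : h k 0 = 0.
Proof. by apply: (addIr (h k 0)); rewrite -hD !add0r. Qed.

Lemma malg_extw f (d : {fset K}) : (msupp f `<=` d)%fset ->
  malg_ext h f = \sum_(k <- d) h k f@_k.
Proof.
move=> le; rewrite /malg_ext (big_fset_incl _ le)//= => k _ /mcoeff_outdom ->.
exact: malg_ext_h0.
Qed.

Lemma malg_extD f g : malg_ext h (f + g) = malg_ext h f + malg_ext h g.
Proof.
rewrite (malg_extw (fsubsetUl (msupp f) (msupp g))).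
rewrite (malg_extw (fsubsetUr (msupp f) (msupp g))).
rewrite (malg_extw (msuppD_le f g)) -big_split /=.
by apply: eq_bigr => k _; rewrite mcoeffD hD.
Qed.

Lemma malg_extU k a : malg_ext h << a *g k >> = h k a.
Proof. by rewrite (malg_extw msuppU_le) big_seq_fset1 mcoeffUU. Qed.

Lemma malg_ext0 : malg_ext h 0 = 0.
Proof. by rewrite /malg_ext msupp0 big_seq_fset0. Qed.
End Ext.

Lemma eq_malg_ext (Z : zmodType) (h1 h2 : K -> A -> Z) f :
  (forall k a, h1 k a = h2 k a) -> malg_ext h1 f = malg_ext h2 f.
Proof. by move=> h12; apply: eq_bigr. Qed.

Lemma malg_ext_split (Z : zmodType) (h1 h2 : K -> A -> Z) f :
  malg_ext (fun k a => h1 k a + h2 k a) f = malg_ext h1 f + malg_ext h2 f.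
Proof. exact: big_split. Qed.
End MalgExt.

Definition is_basis (A : pzRingType) (M : lmodType A) (I : choiceType)
    (b : I -> M) :=
  forall x, exists! c : {malg A[I]}, x = \sum_(i <- msupp c) c@_i *: b i.

(* The free A-module on G with (a g)(b h) = (a (g . b)) (g h). For a group G
   acting on a k-algebra A by k-algebra automorphisms this is A ><| k[G]; the
   ring structure does not involve k. The monoid algebra R[E] is the case of
   the trivial action (the ring structure on malg needs a nontrivial R). *)
Section Skew.
Variables (A : pzRingType) (G : monoidType) (rho : ring_action G A).

Definition skew_alg (_ : ring_action G A) := {malg A[G]}.
Local Notation S := (skew_alg rho).
HB.instance Definition _ := GRing.Zmodule.on S.

Definition skew_mon (a : A) (g : G) : S := << a *g g >>.

Definition skew_mul (x y : S) : S :=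
  malg_ext (fun g a => malg_ext (fun h b => skew_mon (a * rho g b) (g * h)%g) y) x.

Lemma skew_monD a b g : skew_mon (a + b) g = skew_mon a g + skew_mon b g.
Proof. exact: monalgUD. Qed.

Let in1 g a h b c : skew_mon (a * rho g (b + c)) (g * h)%g =
  skew_mon (a * rho g b) (g * h)%g + skew_mon (a * rho g c) (g * h)%g.
Proof. by rewrite ract_add mulrDr skew_monD. Qed.

Let in2 (y : S) g a b :
  malg_ext (fun h c => skew_mon ((a + b) * rho g c) (g * h)%g) y =
  malg_ext (fun h c => skew_mon (a * rho g c) (g * h)%g) y +
  malg_ext (fun h c => skew_mon (b * rho g c) (g * h)%g) y.
Proof.
rewrite -malg_ext_split; apply: eq_malg_ext => h c.
by rewrite mulrDl skew_monD.
Qed.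

Lemma skew_mulDl : left_distributive skew_mul +%R.
Proof. by move=> x y z; apply: malg_extD => g a b; exact: in2. Qed.

Lemma skew_mulDr : right_distributive skew_mul +%R.
Proof.
move=> x y z; rewrite /skew_mul -malg_ext_split; apply: eq_malg_ext => g a.
by apply: malg_extD => h b c; exact: in1.
Qed.

Lemma skew_mulUU a g b h :
  skew_mul (skew_mon a g) (skew_mon b h) = skew_mon (a * rho g b) (g * h)%g.
Proof.
rewrite /skew_mul malg_extU => [|g' a' b']; last exact: in2.
by rewrite malg_extU// => h' b' c'; exact: in1.
Qed.

Lemma skew_mul0 : left_zero 0 skew_mul.
Proof. by move=> x; apply: (addIr (skew_mul 0 x)); rewrite -skew_mulDl !add0r. Qed.
Lemma skew_mulr0 : right_zero 0 skew_mul.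
Proof. by move=> x; apply: (addIr (skew_mul x 0)); rewrite -skew_mulDr !add0r. Qed.

Lemma skew_mulA : associative skew_mul.
Proof.
move=> x y z; elim/malg_ind: x => [|g a|x x' IH IH'].
- by rewrite !skew_mul0.
- elim/malg_ind: y => [|h b|y y' IH IH'].
  + by rewrite skew_mul0 skew_mulr0 skew_mul0.
  + elim/malg_ind: z => [|k c|z z' IH IH'].
    * by rewrite !skew_mulr0.
    * rewrite -!/(skew_mon _ _) !skew_mulUU ract_mul mulrA.
      by rewrite ractM mulgA.
    * by rewrite !skew_mulDr IH IH'.
  + by rewrite !skew_mulDr !skew_mulDl !skew_mulDr IH IH'.
- by rewrite !skew_mulDl IH IH'.
Qed.

Lemma skew_mul1 : left_id (skew_mon 1 1%g) skew_mul.
Proof.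
move=> x; elim/malg_ind: x => [|g a|x y IH IH']; first by rewrite skew_mulr0.
  by rewrite -/(skew_mon _ _) skew_mulUU ract1 mul1r mul1g.
by rewrite skew_mulDr IH IH'.
Qed.

Lemma skew_mulr1 : right_id (skew_mon 1 1%g) skew_mul.
Proof.
move=> x; elim/malg_ind: x => [|g a|x y IH IH']; first by rewrite skew_mul0.
  by rewrite -/(skew_mon _ _) skew_mulUU ract_one mulr1 mulg1.
by rewrite skew_mulDl IH IH'.
Qed.

HB.instance Definition _ := GRing.Zmodule_isPzRing.Build S
  skew_mulA skew_mul1 skew_mulr1 skew_mulDl skew_mulDr.

Lemma skew_monM a g b h :
  skew_mon a g * skew_mon b h = skew_mon (a * rho g b) (g * h)%g.
Proof. exact: skew_mulUU. Qed.

Lemma skew_mon1 : skew_mon 1 1%g = 1.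
Proof. by []. Qed.
End Skew.

Section MonoidAlgebra.
Variables (R : comPzRingType) (E : comMonoidType).

Definition monoid_alg := skew_alg (triv_action E R).
HB.instance Definition _ := GRing.PzRing.on monoid_alg.

Lemma monoid_alg_mulC : commutative ( *%R : monoid_alg -> _).
Proof.
move=> x y; elim/malg_ind: x => [|g a|x x' IH IH'].
- by rewrite mul0r mulr0.
- elim/malg_ind: y => [|h b|y y' IH IH'].
  + by rewrite mul0r mulr0.
  + rewrite -!/(skew_mon (triv_action E R) _ _) !skew_monM /=.
    by rewrite mulrC commgC.
  + by rewrite mulrDl mulrDr IH IH'.
- by rewrite mulrDl mulrDr IH IH'.
Qed.
HB.instance Definition _ :=
  GRing.PzRing_hasCommutativeMul.Build monoid_alg monoid_alg_mulC.

Definition malg_mon (r : R) (x : E) : monoid_alg := << r *g x >>.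
Definition malg_scal (r : R) : monoid_alg := malg_mon r 1%g.
Definition malg_elt (x : E) : monoid_alg := malg_mon 1 x.

Lemma malg_monD r s x : malg_mon (r + s) x = malg_mon r x + malg_mon s x.
Proof. exact: monalgUD. Qed.

Lemma malg_monM r s x y :
  malg_mon r x * malg_mon s y = malg_mon (r * s) (x * y)%g.
Proof. exact: skew_monM. Qed.

Lemma malg_scal_is_nmod : nmod_morphism malg_scal.
Proof. by split=> [|r s]; [exact: monalgU0|exact: malg_monD]. Qed.
Lemma malg_scal_is_monoid : GRing.monoid_morphism malg_scal.
Proof. by split=> [|r s] //; rewrite malg_monM mulg1. Qed.
HB.instance Definition _ :=
  GRing.isNmodMorphism.Build R monoid_alg malg_scal malg_scal_is_nmod.
HB.instance Definition _ :=
  GRing.isMonoidMorphism.Build R monoid_alg malg_scal malg_scal_is_monoid.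

Definition augmentation (f : monoid_alg) : R := malg_ext (fun _ r => r) f.

Section LinearExtension.
Variables (G : monoidType) (rho : monoid_action G E).

Definition lin_act (g : G) (f : monoid_alg) : monoid_alg :=
  malg_ext (fun x r => malg_mon r (rho g x)) f.

Lemma lin_actD g f f' : lin_act g (f + f') = lin_act g f + lin_act g f'.
Proof. by apply: malg_extD => x r s; exact: malg_monD. Qed.
Lemma lin_actU g r x : lin_act g (malg_mon r x) = malg_mon r (rho g x).
Proof. by apply: malg_extU => y s t; exact: malg_monD. Qed.
Lemma lin_act0 g : lin_act g 0 = 0.
Proof. exact: malg_ext0. Qed.
Lemma lin_act1 f : lin_act 1%g f = f.
Proof.
elim/malg_ind: f => [|x r|f f' IH IH']; first exact: lin_act0.
  by rewrite -/(malg_mon r x) lin_actU mact1.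
by rewrite lin_actD IH IH'.
Qed.
Lemma lin_actM g h f : lin_act (g * h)%g f = lin_act g (lin_act h f).
Proof.
elim/malg_ind: f => [|x r|f f' IH IH']; first by rewrite !lin_act0.
  by rewrite -/(malg_mon r x) !lin_actU mactM.
by rewrite !lin_actD IH IH'.
Qed.
Lemma lin_act_scal g r : lin_act g (malg_scal r) = malg_scal r.
Proof. by rewrite lin_actU mact_one. Qed.
Lemma lin_act_one g : lin_act g 1 = 1.
Proof. exact: lin_act_scal. Qed.
Lemma lin_act_mul g f f' : lin_act g (f * f') = lin_act g f * lin_act g f'.
Proof.
elim/malg_ind: f => [|x r|f1 f2 IH IH']; first by rewrite lin_act0 !mul0r lin_act0.
  elim/malg_ind: f' => [|y s|f1 f2 IH IH']; first by rewrite lin_act0 !mulr0 lin_act0.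
    by rewrite -/(malg_mon r x) -/(malg_mon s y) malg_monM !lin_actU malg_monM mact_mul.
  by rewrite mulrDr !lin_actD mulrDr IH IH'.
by rewrite mulrDl !lin_actD mulrDl IH IH'.
Qed.

Definition lin_action : ring_action G monoid_alg :=
  RingAction lin_act1 lin_actM lin_act_one lin_actD lin_act_mul.
End LinearExtension.
End MonoidAlgebra.

Section RingQuotient.
Variable A : pzRingType.

Inductive ideal_gen (X : set A) : set A :=
| ideal_mem x : X x -> ideal_gen X x
| ideal_0 : ideal_gen X 0
| ideal_add x y : ideal_gen X x -> ideal_gen X y -> ideal_gen X (x + y)
| ideal_mull a x : ideal_gen X x -> ideal_gen X (a * x)
| ideal_mulr x a : ideal_gen X x -> ideal_gen X (x * a).

Variable X : set A.

Definition ideal_eqb : rel A := fun x y => `[< ideal_gen X (x - y) >].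

Lemma ideal_opp x : ideal_gen X x -> ideal_gen X (- x).
Proof. by rewrite -mulN1r; exact: ideal_mull. Qed.
Lemma ideal_eqb_refl : reflexive ideal_eqb.
Proof. by move=> x; apply/asboolP; rewrite subrr; exact: ideal_0. Qed.
Lemma ideal_eqb_sym : symmetric ideal_eqb.
Proof. by move=> x y; apply/asboolP/asboolP => /ideal_opp; rewrite opprB. Qed.
Lemma ideal_eqb_trans : transitive ideal_eqb.
Proof.
move=> y x z /asboolP xy /asboolP yz; apply/asboolP.
by have := ideal_add xy yz; rewrite addrA subrK.
Qed.

Canonical ideal_equiv :=
  EquivRel ideal_eqb ideal_eqb_refl ideal_eqb_sym ideal_eqb_trans.

Definition ring_quot := {eq_quot ideal_eqb}%qT.
HB.instance Definition _ := EqQuotient.on ring_quot.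
HB.instance Definition _ := Choice.on ring_quot.

Definition rq_class (x : A) : ring_quot := (\pi_ring_quot x)%qT.

Lemma rq_classP x y : rq_class x = rq_class y <-> ideal_gen X (x - y).
Proof.
split=> [/eqP|h]; first by rewrite /rq_class eqmodE => /asboolP.
by apply/eqP; rewrite /rq_class eqmodE; apply/asboolP.
Qed.

Lemma rq_reprK (q : ring_quot) : rq_class (repr q) = q.
Proof. exact: reprK. Qed.

Lemma rq_repr x : ideal_gen X (repr (rq_class x) - x).
Proof. by apply/rq_classP; rewrite rq_reprK. Qed.

Definition rq_opp (q : ring_quot) := rq_class (- repr q).
Definition rq_add (q r : ring_quot) := rq_class (repr q + repr r).
Definition rq_mul (q r : ring_quot) := rq_class (repr q * repr r).

Lemma rq_oppE x : rq_opp (rq_class x) = rq_class (- x).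
Proof. by apply/rq_classP; rewrite -opprD; exact/ideal_opp/rq_repr. Qed.
Lemma rq_addE x y : rq_add (rq_class x) (rq_class y) = rq_class (x + y).
Proof.
by apply/rq_classP; rewrite opprD addrACA; apply: ideal_add; exact: rq_repr.
Qed.
Lemma rq_mulE x y : rq_mul (rq_class x) (rq_class y) = rq_class (x * y).
Proof.
apply/rq_classP; set x' := repr _; set y' := repr _.
have -> : x' * y' - x * y = x' * (y' - y) + (x' - x) * y.
  by rewrite mulrBr mulrBl addrA subrK.
by apply: ideal_add; [apply: ideal_mull|apply: ideal_mulr]; exact: rq_repr.
Qed.

Let rqE := (rq_oppE, rq_addE, rq_mulE).
Lemma rq_addA : associative rq_add.
Proof.
by move=> p q r; rewrite -(rq_reprK p) -(rq_reprK q) -(rq_reprK r) !rqE addrA.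
Qed.
Lemma rq_addC : commutative rq_add.
Proof. by move=> p q; rewrite -(rq_reprK p) -(rq_reprK q) !rqE addrC. Qed.
Lemma rq_add0 : left_id (rq_class 0) rq_add.
Proof. by move=> p; rewrite -(rq_reprK p) !rqE add0r. Qed.
Lemma rq_addN : left_inverse (rq_class 0) rq_opp rq_add.
Proof. by move=> p; rewrite -(rq_reprK p) !rqE addNr. Qed.
Lemma rq_mulA : associative rq_mul.
Proof.
by move=> p q r; rewrite -(rq_reprK p) -(rq_reprK q) -(rq_reprK r) !rqE mulrA.
Qed.
Lemma rq_mul1 : left_id (rq_class 1) rq_mul.
Proof. by move=> p; rewrite -(rq_reprK p) !rqE mul1r. Qed.
Lemma rq_mulr1 : right_id (rq_class 1) rq_mul.
Proof. by move=> p; rewrite -(rq_reprK p) !rqE mulr1. Qed.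
Lemma rq_mulDl : left_distributive rq_mul rq_add.
Proof.
by move=> p q r; rewrite -(rq_reprK p) -(rq_reprK q) -(rq_reprK r) !rqE mulrDl.
Qed.
Lemma rq_mulDr : right_distributive rq_mul rq_add.
Proof.
by move=> p q r; rewrite -(rq_reprK p) -(rq_reprK q) -(rq_reprK r) !rqE mulrDr.
Qed.

HB.instance Definition _ := GRing.isPzRing.Build ring_quot
  rq_addA rq_addC rq_add0 rq_addN rq_mulA rq_mul1 rq_mulr1 rq_mulDl rq_mulDr.

Lemma rq_class_is_nmod : nmod_morphism rq_class.
Proof. by split=> // x y; rewrite -rq_addE. Qed.
Lemma rq_class_is_monoid : GRing.monoid_morphism rq_class.
Proof. by split=> // x y; rewrite -rq_mulE. Qed.
HB.instance Definition _ :=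
  GRing.isNmodMorphism.Build A ring_quot rq_class rq_class_is_nmod.
HB.instance Definition _ :=
  GRing.isMonoidMorphism.Build A ring_quot rq_class rq_class_is_monoid.
End RingQuotient.

Definition coxeter_rel (X : choiceType) (m : X -> X -> nat) (w1 w2 : word X) :=
  exists s t, [/\ (0 < m s t)%N,
    w1 = flatten (nseq (m s t) [:: (s, true); (t, true)]) & w2 = [::]].

(* A Coxeter system (W, S), with S given as an injective family of elements of
   order 2. cox_m s t is the order of st, with 0 for infinite order, and
   (W, S) is presented by the relations (st)^(cox_m s t) = 1. *)
Record coxeterSystem := CoxeterSystem {
  cox_group :> groupType;
  simple : choiceType;
  sgen : simple -> cox_group;
  cox_m : simple -> simple -> nat;
  sgen_inj : injective sgen;
  sgen_order2 : forall s, (sgen s ^+ 2 = 1)%g /\ sgen s <> 1%g;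
  cox_m_order : forall s t n, ((sgen s * sgen t) ^+ n = 1)%g <-> (cox_m s t %| n)%N;
  sgen_generate : forall w, exists x : word simple, word_eval sgen x = w;
  cox_presentation : forall x y : word simple,
    word_eval sgen x = word_eval sgen y -> pres_eq (coxeter_rel cox_m) x y }.
Arguments sgen {c}.
Arguments cox_m {c}.

(* S is identified with its index type, so maps on S are maps on simple W. *)
Definition equivariant (W : coxeterSystem) (X : Type) (act : W -> X -> X)
    (f : simple W -> X) :=
  forall s1 s2 w, (w * sgen s1 * w^-1)%g = sgen s2 -> act w (f s1) = f s2.

Section CoxeterTheory.
Variable W : coxeterSystem.
Implicit Types s t : simple W.

Lemma sgenK s : (sgen s * sgen s)%g = 1%g.
Proof. by have [<-] := sgen_order2 s. Qed.

Lemma sgenV s : (sgen s)^-1%g = sgen s.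
Proof. by rewrite -[LHS]mulg1 -(sgenK s) mulgA mulVg mul1g. Qed.

Lemma cox_m_diag s : cox_m s s = 1%N.
Proof. by apply/eqP; rewrite -dvdn1 -cox_m_order; rewrite sgenK. Qed.

Lemma cox_m_sym s t : cox_m s t = cox_m t s.
Proof.
apply/eqP; rewrite eqn_dvd; apply/andP.
have h (a b : simple W) : (cox_m a b %| cox_m b a)%N.
  apply/cox_m_order; have : ((sgen b * sgen a)^-1 ^+ cox_m b a = 1)%g.
    rewrite expVgn; have /cox_m_order -> := dvdnn (cox_m b a).
    by rewrite invg1.
  by rewrite invgM !sgenV.
by split; exact: h.
Qed.

Lemma cox_m_neq1 s t : s <> t -> cox_m s t <> 1%N.
Proof.
move=> st m1; apply: st; apply: sgen_inj.
have /cox_m_order : (cox_m s t %| 1)%N by rewrite m1.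
by rewrite expg1 => h; rewrite -[LHS]mulg1 -(sgenK t) mulgA h mul1g.
Qed.

Definition cox_prod (ss : seq (simple W)) : W := (\prod_(s <- ss) sgen s)%g.

Definition reduced (ss : seq (simple W)) :=
  forall ss', cox_prod ss' = cox_prod ss -> (size ss <= size ss')%N.

Lemma cox_prod_word (x : word (simple W)) :
  cox_prod (unzip1 x) = word_eval sgen x.
Proof.
rewrite /cox_prod /word_eval big_map; apply: eq_bigr => -[s []] _ //=.
by rewrite sgenV.
Qed.

Lemma ex_reduced w : exists ss, cox_prod ss = w /\ reduced ss.
Proof.
pose P n := `[< exists ss, cox_prod ss = w /\ size ss = n >].
have exP : exists n, P n.
  have [x xw] := sgen_generate w; exists (size (unzip1 x)); apply/asboolP.
  by exists (unzip1 x); rewrite cox_prod_word xw.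
case: (ex_minnP exP) => n /asboolP [ss [ssw <-]] min.
exists ss; split=> // ss' ss'w; apply: min; apply/asboolP.
by exists ss'; rewrite ss'w.
Qed.

Definition reduced_expr (w : W) : seq (simple W) := sval (cid (ex_reduced w)).

Fixpoint alternating (s t : simple W) (n : nat) : word (simple W) :=
  if n is n'.+1 then (s, true) :: alternating t s n' else [::].

Definition braid_rel (w1 w2 : word (simple W)) :=
  exists s t, [/\ s <> t, (0 < cox_m s t)%N,
    w1 = alternating s t (cox_m s t) & w2 = alternating t s (cox_m s t)].

Definition braid_group := presented braid_rel.
HB.instance Definition _ := Group.on braid_group.

Definition braid_gen (s : simple W) : braid_group :=
  pres_class braid_rel [:: (s, true)].

Lemma word_eval_alt s t n : ((sgen s * sgen t) ^+ n *
  word_eval sgen (alternating t s n))%g = word_eval sgen (alternating s t n).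
Proof.
have evE s' t' k : word_eval sgen (alternating s' t' k.+1) =
    (sgen s' * word_eval sgen (alternating t' s' k))%g.
  by rewrite /word_eval big_cons.
elim: n s t => [|n IHn] s t; first by rewrite expg0 mul1g.
rewrite !evE expgSr -(mulgA _ (sgen s * sgen t)%g) -(mulgA (sgen s)).
rewrite (mulgA (sgen t)) sgenK mul1g mulgA -(IHn t s) mulgA; congr (_ * _)%g.
elim: n {IHn} => [|n IHn]; first by rewrite expg0 mul1g mulg1.
by rewrite expgS -mulgA IHn expgS !mulgA.
Qed.

Lemma braid_rel_eval w1 w2 :
  braid_rel w1 w2 -> word_eval sgen w1 = word_eval sgen w2.
Proof.
move=> [s [t [_ _ -> ->]]]; rewrite -word_eval_alt.
by have /cox_m_order -> := dvdnn (cox_m s t); rewrite mul1g.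
Qed.

Definition braid_proj : braid_group -> W := pres_lift sgen.

Lemma braid_projM : {morph braid_proj : x y / (x * y)%g}.
Proof. exact/pres_liftM/braid_rel_eval. Qed.
Lemma braid_proj1 : braid_proj 1%g = 1%g.
Proof. exact/pres_lift1/braid_rel_eval. Qed.
Lemma braid_proj_gen s : braid_proj (braid_gen s) = sgen s.
Proof.
rewrite /braid_proj pres_lift_class; last exact: braid_rel_eval.
by rewrite /word_eval big_seq1.
Qed.

(* The lift g_w of w; by Matsumoto's theorem it does not depend on the choice
   of the reduced expression. *)
Definition braid_lift (w : W) : braid_group :=
  (\prod_(s <- reduced_expr w) braid_gen s)%g.
End CoxeterTheory.

Definition invertible (A : comPzRingType) (x : A) := exists y, x * y = 1.

(* A commutative k-algebra A (md_scal is its structure map) with an action of W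
   by k-algebra automorphisms and a W-equivariant map a : S -> A^*. *)
Record marin_datum (W : coxeterSystem) (k : comPzRingType) := MarinDatum {
  md_alg : comPzRingType;
  md_scal : {rmorphism k -> md_alg};
  md_act : ring_action W md_alg;
  md_act_scal : forall w c, md_act w (md_scal c) = md_scal c;
  md_a : simple W -> md_alg;
  md_a_unit : forall s, invertible (md_a s);
  md_a_equiv : equivariant md_act md_a }.

Section MarinRing.
Variables (W : coxeterSystem) (k : comPzRingType) (D : marin_datum W k).
Local Notation A := (md_alg D).

Definition braid_action : ring_action (braid_group W) A.
Proof.
apply: (@RingAction _ _ (fun g => md_act D (braid_proj g))).
- by move=> a; rewrite braid_proj1 ract1.
- by move=> g h a; rewrite braid_projM ractM.
- by move=> g; exact: ract_one.
- by move=> g; exact: ract_add.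
- by move=> g; exact: ract_mul.
Defined.

Definition braid_skew := skew_alg braid_action.
HB.instance Definition _ := GRing.PzRing.on braid_skew.

Definition skew_in (a : A) : braid_skew := skew_mon braid_action a 1%g.
Definition skew_braid (g : braid_group W) : braid_skew :=
  skew_mon braid_action 1 g.

Definition marin_rel : set braid_skew := [set x | exists s : simple W,
  x = skew_braid (braid_gen s) ^+ 2 - skew_in (md_a D s)
      - skew_in (1 - md_a D s) * skew_braid (braid_gen s)].

Definition marin_ring := ring_quot marin_rel.
HB.instance Definition _ := GRing.PzRing.on marin_ring.

Definition marin_in (a : A) : marin_ring := rq_class marin_rel (skew_in a).
Definition marin_scal (c : k) : marin_ring := marin_in (md_scal D c).
Definition marin_braid (g : braid_group W) : marin_ring :=
  rq_class marin_rel (skew_braid g).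

Lemma marin_in1 : marin_in 1 = 1.
Proof. by []. Qed.
Lemma marin_inD a b : marin_in (a + b) = marin_in a + marin_in b.
Proof. by rewrite /marin_in -rmorphD; congr rq_class; exact: skew_monD. Qed.
Lemma marin_inM a b : marin_in (a * b) = marin_in a * marin_in b.
Proof.
rewrite /marin_in -rmorphM; congr rq_class.
by rewrite /skew_in skew_monM ract1 mulg1.
Qed.

Definition marin_scale (a : A) (x : marin_ring) : marin_ring := marin_in a * x.
Lemma marin_scaleA a b x : marin_scale a (marin_scale b x) = marin_scale (a * b) x.
Proof. by rewrite /marin_scale marin_inM mulrA. Qed.
Lemma marin_scale1 : left_id 1 marin_scale.
Proof. by move=> x; rewrite /marin_scale marin_in1 mul1r. Qed.
Lemma marin_scaleDr : right_distributive marin_scale +%R.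
Proof. by move=> a x y; exact: mulrDr. Qed.
Lemma marin_scaleDl x : {morph marin_scale^~ x : a b / a + b}.
Proof. by move=> a b; rewrite /marin_scale marin_inD mulrDl. Qed.
HB.instance Definition _ := GRing.Zmodule_isLmodule.Build A marin_ring
  marin_scaleA marin_scale1 marin_scaleDr marin_scaleDl.
End MarinRing.
Arguments marin_in {W k} D a.
Arguments marin_scal {W k} D c.
Arguments marin_braid {W k} D g.

(* The Iwahori-Hecke algebra H_R(W,S)(u) is the Marin ring of hecke_datum. *)
Section Hecke.
Variables (W : coxeterSystem) (R : comPzRingType) (u : simple W -> R).
Hypothesis u_unit : forall s, invertible (u s).
Hypothesis u_equiv : equivariant (fun _ (x : R) => x) u.

Definition hecke_datum : marin_datum W R :=
  @MarinDatum W R R idfun (triv_action W R) (fun _ _ => erefl) u u_unit u_equiv.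
End Hecke.

Definition is_MIH_monoid (W : coxeterSystem) (E : comMonoidType)
    (rho : monoid_action W E) (e : simple W -> E) :=
  [/\ forall s, (e s * e s)%g = e s,
      equivariant rho e &
      forall s x, (e s * x)%g = (e s * rho (sgen s) x)%g].

(* The submonoid generated by the w.e_s. *)
Section OrbitMonoid.
Variables (W : coxeterSystem) (M : comMonoidType) (rho : monoid_action W M).
Variable e : simple W -> M.

Inductive orbit_gen : M -> Prop :=
| orbit_gen_e w s : orbit_gen (rho w (e s))
| orbit_gen1 : orbit_gen 1%g
| orbit_genM x y : orbit_gen x -> orbit_gen y -> orbit_gen (x * y)%g.

Definition orbit_pred : pred M := fun x => `[< orbit_gen x >].
Record orbit_monoid := OrbitMonoid { orbit_val : M; _ : orbit_pred orbit_val }.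
HB.instance Definition _ := [isSub for orbit_val].
HB.instance Definition _ := [Choice of orbit_monoid by <:].

Lemma orbit_pred_closed : monoid_closed orbit_pred.
Proof.
split; first by apply/asboolP; exact: orbit_gen1.
by move=> x y /asboolP hx /asboolP hy; apply/asboolP; exact: orbit_genM.
Qed.
HB.instance Definition _ :=
  SubChoice_isSubMonoid.Build M orbit_pred orbit_monoid orbit_pred_closed.

Lemma orbit_mulC (x y : orbit_monoid) : (x * y = y * x)%g.
Proof. by apply: val_inj; rewrite !gmulfM commgC. Qed.
HB.instance Definition _ := Monoid_isCommutative.Build orbit_monoid orbit_mulC.

Lemma orbit_act_subproof w (x : orbit_monoid) : orbit_pred (rho w (val x)).
Proof.
case: x => x /= /asboolP hx; apply/asboolP.
elim: hx => {x} [w' s||x y _ IHx _ IHy].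
- by rewrite -mactM; exact: orbit_gen_e.
- by rewrite mact_one; exact: orbit_gen1.
- by rewrite mact_mul; exact: orbit_genM.
Qed.
Definition orbit_act w (x : orbit_monoid) : orbit_monoid :=
  OrbitMonoid (orbit_act_subproof w x).

Definition orbit_action : monoid_action W orbit_monoid.
Proof.
apply: (@MonoidAction _ _ orbit_act).
- by move=> x; apply: val_inj; exact: mact1.
- by move=> v w x; apply: val_inj; exact: mactM.
- by move=> w; apply: val_inj; exact: mact_one.
- by move=> w x y; apply: val_inj; exact: mact_mul.
Defined.

Lemma orbit_e_subproof s : orbit_pred (e s).
Proof. by apply/asboolP; rewrite -[e s](mact1 rho); exact: orbit_gen_e. Qed.
Definition orbit_e s : orbit_monoid := OrbitMonoid (orbit_e_subproof s).
End OrbitMonoid.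

Section GeometricRepresentation.
Variables (K : realType) (U : coxeterSystem).
Implicit Types s t : simple U.

Definition geom := {malg K[simple U]}.
HB.instance Definition _ := GRing.Lmodule.on geom.
Implicit Types v w b : geom.

Definition sroot s : geom := << s >>.

(* cox_m s t = 0 encodes m_{s,t} = oo. *)
Definition cox_form s t : K :=
  if cox_m s t == 0%N then -1 else - cos (pi / (cox_m s t)%:R).

Definition geom_form v w : K :=
  \sum_(s <- msupp v) \sum_(t <- msupp w) v@_s * w@_t * cox_form s t.

Definition refl b v : geom := v - (2 * geom_form v b) *: b.

Lemma geom_formE v w : geom_form v w =
  malg_ext (fun s a => malg_ext (fun t c => a * c * cox_form s t) w) v.
Proof. by []. Qed.

Lemma cox_form_sym s t : cox_form s t = cox_form t s.
Proof. by rewrite /cox_form cox_m_sym. Qed.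

Lemma cox_form_diag s : cox_form s s = 1.
Proof. by rewrite /cox_form cox_m_diag /= divr1 cospi opprK. Qed.

Lemma geom_formC v w : geom_form v w = geom_form w v.
Proof.
rewrite /geom_form exchange_big; apply: eq_bigr => t _; apply: eq_bigr => s _.
by rewrite cox_form_sym (mulrC v@_s).
Qed.

Lemma geom_formDl v v' w :
  geom_form (v + v') w = geom_form v w + geom_form v' w.
Proof.
rewrite !geom_formE; apply: malg_extD => s a a'; rewrite -malg_ext_split.
by apply: eq_malg_ext => t c; rewrite !mulrDl.
Qed.

Lemma geom_formZl a v w : geom_form (a *: v) w = a * geom_form v w.
Proof.
have -> : geom_form (a *: v) w =
    \sum_(s <- msupp v) \sum_(t <- msupp w) a * v@_s * w@_t * cox_form s t.
  rewrite geom_formE (malg_extw _ (msuppZ_le a v)) => [|s c c'].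
    by apply: eq_bigr => s _; rewrite mcoeffZ.
  rewrite -malg_ext_split; apply: eq_malg_ext => t d.
  by rewrite !mulrDl.
rewrite /geom_form mulr_sumr; apply: eq_bigr => s _.
by rewrite mulr_sumr; apply: eq_bigr => t _; rewrite !mulrA.
Qed.

Lemma geom_formDr v w w' :
  geom_form v (w + w') = geom_form v w + geom_form v w'.
Proof. by rewrite !(geom_formC v) geom_formDl. Qed.

Lemma geom_formZr a v w : geom_form v (a *: w) = a * geom_form v w.
Proof. by rewrite !(geom_formC v) geom_formZl. Qed.

Lemma geom_formNl v w : geom_form (- v) w = - geom_form v w.
Proof. by rewrite -scaleN1r geom_formZl mulN1r. Qed.

Lemma geom_formNr v w : geom_form v (- w) = - geom_form v w.
Proof. by rewrite !(geom_formC v) geom_formNl. Qed.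

Let formE := (geom_formDl, geom_formDr, geom_formNl, geom_formNr,
              geom_formZl, geom_formZr).

Lemma geom_form_sroot s t : geom_form (sroot s) (sroot t) = cox_form s t.
Proof.
have U1 r : msupp (sroot r) = [fset r]%fset by rewrite msuppU oner_eq0.
by rewrite /geom_form !U1 !big_seq_fset1 !mcoeffUU !mul1r.
Qed.

Lemma refl_form b v w : geom_form b b = 1 ->
  geom_form (refl b v) (refl b w) = geom_form v w.
Proof.
move=> b1; rewrite /refl !formE b1 (geom_formC b w).
by ring.
Qed.

Lemma reflK b : geom_form b b = 1 -> involutive (refl b).
Proof.
move=> b1 v; rewrite /refl !formE b1 mulr1 -addrA -opprD -scalerDl.
rewrite [X in X *: _](_ : _ = 0) ?scale0r ?subr0//.
by ring.
Qed.

Lemma reflD b v w : refl b (v + w) = refl b v + refl b w.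
Proof. by rewrite /refl geom_formDl mulrDr scalerDl opprD addrACA. Qed.

Lemma reflZ b a v : refl b (a *: v) = a *: refl b v.
Proof. by rewrite /refl geom_formZl scalerBr scalerA mulrCA. Qed.

Lemma refl_orth b v : geom_form v b = 0 -> refl b v = v.
Proof. by move=> vb; rewrite /refl vb mulr0 scale0r subr0. Qed.

Let rot s t v := refl (sroot s) (refl (sroot t) v).

Let rotD s t n v w : iter n (rot s t) (v + w) =
  iter n (rot s t) v + iter n (rot s t) w.
Proof.
elim: n => [|n IHn]; first by [].
by rewrite iterS IHn [in RHS]iterS [in RHS]iterS /rot reflD reflD.
Qed.

Let rotZ s t n a v : iter n (rot s t) (a *: v) = a *: iter n (rot s t) v.
Proof.
elim: n => [|n IHn]; first by [].
by rewrite iterS IHn [in RHS]iterS /rot reflZ reflZ.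
Qed.

Lemma rot_order s t v : (0 < cox_m s t)%N -> iter (cox_m s t) (rot s t) v = v.
Proof.
move=> m0; case: (pselect (s = t)) => [<-|st].
  by rewrite cox_m_diag /= /rot reflK// geom_form_sroot cox_form_diag.
set m := cox_m s t in m0 *; pose th : K := pi / m%:R.
have m2 : (1 < m)%N by have := cox_m_neq1 st; rewrite -/m; case: (m) m0 => [|[|]].
have mR : (0 : K) < m%:R by rewrite ltr0n.
have th0 : 0 < sin th.
  apply: sin_gt0_pi; rewrite divr_gt0 ?pi_gt0//= ltr_pdivrMr//.
  by rewrite ltr_pMr ?pi_gt0// ltr1n.
have Bst : geom_form (sroot s) (sroot t) = - cos th.
  by rewrite geom_form_sroot /cox_form -/m; case: eqP m0 => // ->.
have Bss : geom_form (sroot s) (sroot s) = 1.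
  by rewrite geom_form_sroot cox_form_diag.
have Btt : geom_form (sroot t) (sroot t) = 1.
  by rewrite geom_form_sroot cox_form_diag.
have Bts : geom_form (sroot t) (sroot s) = - cos th by rewrite geom_formC.
pose f (x : K) : geom := sin x *: sroot s + sin (x + th) *: sroot t.
have cs : cos th ^+ 2 + sin th ^+ 2 = 1 by exact: cos2Dsin2.
have rotf x : rot s t (f x) = f (x - th *+ 2).
  have reflt : refl (sroot t) (f x) = sin x *: sroot s + sin (x - th) *: sroot t.
    have E : geom_form (f x) (sroot t) =
        sin (x + th) - sin x * cos th.
      by rewrite /f geom_formDl !geom_formZl Bst Btt; ring.
    have E' : sin (x + th) - 2 * (sin (x + th) - sin x * cos th) = sin (x - th).
      by rewrite sinD sinB; ring.
    by rewrite /refl E /f -addrA -scalerBl E'.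
  have E : sin x - 2 * (sin x - sin (x - th) * cos th) = sin (x - th - th).
    rewrite (sinB (x - th)) sinB cosB; set S := sin x; set C := cos x.
    have -> : S - 2 * (S - (S * cos th - C * sin th) * cos th) =
      S * (2 * cos th ^+ 2 - 1) - 2 * C * cos th * sin th by ring.
    have -> : 2 * cos th ^+ 2 - 1 = cos th ^+ 2 - sin th ^+ 2.
      by rewrite -[X in _ - X]cs; ring.
    by ring.
  have E' : geom_form (sin x *: sroot s + sin (x - th) *: sroot t) (sroot s) =
      sin x - sin (x - th) * cos th.
    by rewrite geom_formDl !geom_formZl Bss Bts; ring.
  rewrite /rot reflt /refl E' addrAC -scalerBl E /f.
  have -> : x - th *+ 2 + th = x - th by ring.
  by have -> : x - th *+ 2 = x - th - th by ring.
have iterf n x : iter n (rot s t) (f x) = f (x - th *+ 2 *+ n).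
  elim: n => [|n IHn]; first by rewrite mulr0n subr0.
  by rewrite iterS IHn rotf -addrA -opprD -mulrSr.
have fixf x : iter m (rot s t) (f x) = f x.
  rewrite iterf.
  have -> : th *+ 2 *+ m = pi *+ 2.
    by rewrite /th -mulrnA mulnC mulrnA -[_ *+ m]mulr_natr divfK// gt_eqF.
  rewrite /f -addrA (addrC (- _)) addrA -[in LHS](sinD2pi (x - _)) subrK.
  by rewrite -[sin (_ - _)]sinD2pi subrK.
have fixs : iter m (rot s t) (sroot s) = sroot s.
  have -> : sroot s = (- (sin th)^-1) *: f (- th).
    rewrite /f addNr sin0 scale0r addr0 sinN scalerA mulrNN mulVf ?scale1r//.
    by rewrite gt_eqF.
  by rewrite rotZ fixf.
have fixt : iter m (rot s t) (sroot t) = sroot t.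
  have -> : sroot t = (sin th)^-1 *: f 0.
    rewrite /f sin0 scale0r !add0r scalerA mulVf ?scale1r//.
    by rewrite gt_eqF.
  by rewrite rotZ fixf.
pose x := geom_form v (sroot s); pose y := geom_form v (sroot t).
pose d := (sin th ^+ 2)^-1.
pose p : geom := (d * (x + cos th * y)) *: sroot s + (d * (y + cos th * x)) *: sroot t.
have s2 : sin th ^+ 2 = 1 - cos th ^+ 2 by rewrite -cs addrAC subrr add0r.
have dE : d * (1 - cos th ^+ 2) = 1.
  by rewrite /d s2 mulVf// -s2 sqrf_eq0 gt_eqF.
have fixp : iter m (rot s t) p = p by rewrite rotD !rotZ fixs fixt.
have ps : geom_form p (sroot s) = x.
  rewrite !formE Bss Bts mulr1 -[RHS]mulr1 -dE; ring.
have pt : geom_form p (sroot t) = y.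
  rewrite !formE Btt Bst mulr1 -[RHS]mulr1 -dE; ring.
have qs : geom_form (v - p) (sroot s) = 0.
  by rewrite geom_formDl geom_formNl ps subrr.
have qt : geom_form (v - p) (sroot t) = 0.
  by rewrite geom_formDl geom_formNl pt subrr.
have fixq : iter m (rot s t) (v - p) = v - p.
  elim: (m) => [|n IHn]; first by [].
  by rewrite iterS IHn /rot (refl_orth qt) (refl_orth qs).
by rewrite -[v in LHS](subrK p) rotD fixq fixp subrK.
Qed.

(* The operator of a word; for a reflection s and s^-1 act in the same way. *)
Definition word_act (x : word (simple U)) (v : geom) : geom :=
  foldr (fun l => refl (sroot l.1)) v x.

Lemma word_act_cat x y v : word_act (x ++ y) v = word_act x (word_act y v).
Proof. exact: foldr_cat. Qed.

Lemma sroot_reflK s : involutive (refl (sroot s)).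
Proof. by apply: reflK; rewrite geom_form_sroot cox_form_diag. Qed.

Lemma word_act_pres x y :
  pres_eq (coxeter_rel cox_m) x y -> word_act x =1 word_act y.
Proof.
elim=> {x y} [_ _ [s [t [m0 -> ->]]]|s b|x x' y y' _ IHx _ IHy|//|
              x y _ IH|x y z _ IH1 _ IH2] v.
- rewrite -[RHS](rot_order v m0).
  elim: (cox_m s t) => [|n IHn]; first by [].
  by rewrite iterS -IHn.
- exact: sroot_reflK.
- by rewrite !word_act_cat IHy IHx.
- by rewrite IH.
- by rewrite IH1 IH2.
Qed.

Definition geom_word (u : U) : word (simple U) := sval (cid (sgen_generate u)).

Lemma geom_wordK u : word_eval sgen (geom_word u) = u.
Proof. exact: (svalP (cid (sgen_generate u))). Qed.

Definition geom_act (u : U) (v : geom) : geom := word_act (geom_word u) v.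

Lemma geom_act_word x : geom_act (word_eval sgen x) =1 word_act x.
Proof. by apply/word_act_pres/cox_presentation; rewrite geom_wordK. Qed.

Lemma geom_act_gen s v : geom_act (sgen s) v = refl (sroot s) v.
Proof.
have -> : sgen s = word_eval sgen [:: (s, true)] by rewrite /word_eval big_seq1.
by rewrite geom_act_word.
Qed.

Lemma geom_act1 v : geom_act 1%g v = v.
Proof.
have -> : 1%g = word_eval sgen [::] :> U by rewrite /word_eval big_nil.
by rewrite geom_act_word.
Qed.

Lemma geom_actM u u' v : geom_act (u * u')%g v = geom_act u (geom_act u' v).
Proof.
rewrite -(geom_wordK u) -(geom_wordK u') -word_eval_cat !geom_act_word.
exact: word_act_cat.
Qed.

Lemma geom_act_form u v w : geom_form (geom_act u v) (geom_act u w) = geom_form v w.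
Proof.
rewrite /geom_act; elim: (geom_word u) => //= -[s b] x IHx.
by rewrite refl_form ?IHx// geom_form_sroot cox_form_diag.
Qed.

Lemma geom_actD u v w : geom_act u (v + w) = geom_act u v + geom_act u w.
Proof.
by rewrite /geom_act; elim: (geom_word u) => //= l x ->; rewrite reflD.
Qed.

Lemma geom_actZ u a v : geom_act u (a *: v) = a *: geom_act u v.
Proof.
by rewrite /geom_act; elim: (geom_word u) => //= l x ->; rewrite reflZ.
Qed.

Definition roots : set geom := [set b | exists u s, b = geom_act u (sroot s)].

Definition is_root_subsystem (Psi : set geom) :=
  Psi `<=` roots /\ forall b, Psi b -> refl b @` Psi = Psi.

Lemma root_form b : roots b -> geom_form b b = 1.
Proof.
by move=> [u [s ->]]; rewrite geom_act_form geom_form_sroot cox_form_diag.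
Qed.

Lemma geom_act_refl u b v :
  geom_act u (refl b v) = refl (geom_act u b) (geom_act u v).
Proof. by rewrite /refl geom_act_form -scaleNr geom_actD geom_actZ scaleNr. Qed.

Lemma refl_roots b c : roots b -> roots c -> roots (refl b c).
Proof.
move=> [u [s ->]] [u' [s' ->]]; exists (u * sgen s * u^-1 * u')%g, s'.
rewrite !geom_actM geom_act_gen geom_act_refl; congr (refl _ _).
by rewrite -!geom_actM ?mulgA mulgV mul1g.
Qed.

Lemma root_subsystemP (Psi : set geom) : is_root_subsystem Psi <->
  Psi `<=` roots /\ forall b c, Psi b -> Psi c -> Psi (refl b c).
Proof.
split=> -[PR h]; split=> // b.
  by move=> c Pb Pc; rewrite -(h _ Pb); exists c.
move=> Pb; apply/seteqP; split=> [_ [c Pc <-]|c Pc]; first exact: h.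
exists (refl b c); first exact: h.
exact/reflK/root_form/PR.
Qed.

Lemma roots_subsystem : is_root_subsystem roots.
Proof. by apply/root_subsystemP; split=> //; exact: refl_roots. Qed.

Lemma set0_subsystem : is_root_subsystem set0.
Proof. by apply/root_subsystemP; split. Qed.

Definition generated (X : set geom) : set geom := smallest is_root_subsystem X.

Lemma generated_subsystem (X : set geom) :
  X `<=` roots -> is_root_subsystem (generated X).
Proof.
move=> XR; apply/root_subsystemP; split.
  by apply: smallest_sub => //; exact: roots_subsystem.
move=> b c hb hc P [PP XP]; have /root_subsystemP[_] := PP; apply.
  exact: hb.
exact: hc.
Qed.

Definition subsystem_pred : pred (set geom) :=
  fun Psi => `[< is_root_subsystem Psi >].
Record root_subsystem := RootSubsystem {
  rs_set :> set geom; _ : subsystem_pred rs_set }.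
HB.instance Definition _ := [isSub for rs_set].
HB.instance Definition _ := [Choice of root_subsystem by <:].

Lemma rsP (Psi : root_subsystem) : is_root_subsystem Psi.
Proof. by case: Psi => P /= /asboolP. Qed.

Definition mk_rs (Psi : set geom) (h : is_root_subsystem Psi) :=
  RootSubsystem (asboolT h).

Lemma rs_eqP (P Q : root_subsystem) : P `<=>` Q -> P = Q.
Proof. by move=> [PQ QP]; apply/val_inj/seteqP. Qed.

Lemma rs_mul_subproof (P Q : root_subsystem) :
  is_root_subsystem (generated (P `|` Q)).
Proof.
have [[hP _] [hQ _]] := (rsP P, rsP Q).
by apply: generated_subsystem => b [/hP|/hQ].
Qed.
Definition rs_mul (P Q : root_subsystem) := mk_rs (rs_mul_subproof P Q).
Definition rs_one := mk_rs set0_subsystem.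

Lemma rs_mul_sub (P Q N : root_subsystem) :
  rs_mul P Q `<=` N <-> P `<=` N /\ Q `<=` N.
Proof.
split=> [h|[h1 h2]].
  split=> b hb; apply: h => M [_ PQM]; apply: PQM; [by left|by right].
apply: smallest_sub; first exact: rsP.
by move=> b []; [exact: h1|exact: h2].
Qed.

Lemma rs_mulA : associative rs_mul.
Proof.
move=> P Q N.
have [_] := rs_mul_sub P (rs_mul Q N) (rs_mul (rs_mul P Q) N).
have [_] := rs_mul_sub (rs_mul P Q) N (rs_mul P (rs_mul Q N)).
have [/(_ (fun _ => id)) [hPN hN] _] :=
  rs_mul_sub (rs_mul P Q) N (rs_mul (rs_mul P Q) N).
have [/(_ (fun _ => id)) [hP hQN] _] :=
  rs_mul_sub P (rs_mul Q N) (rs_mul P (rs_mul Q N)).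
have [/(_ hPN) [hP1 hQ1] _] := rs_mul_sub P Q (rs_mul (rs_mul P Q) N).
have [/(_ hQN) [hQ2 hN2] _] := rs_mul_sub Q N (rs_mul P (rs_mul Q N)).
move=> i1 i2; apply: rs_eqP; split; [apply: i2|apply: i1]; split=> //.
  exact/rs_mul_sub.
exact/rs_mul_sub.
Qed.

Lemma rs_mulC : commutative rs_mul.
Proof. by move=> P Q; apply: val_inj; rewrite /= setUC. Qed.

Lemma rs_mul1 : left_id rs_one rs_mul.
Proof.
move=> P; apply: val_inj; rewrite /= set0U.
by apply: smallest_id; exact: rsP.
Qed.

Lemma rs_mulr1 : right_id rs_one rs_mul.
Proof. by move=> P; rewrite rs_mulC rs_mul1. Qed.

HB.instance Definition _ :=
  isMonoid.Build root_subsystem rs_mulA rs_mul1 rs_mulr1.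
HB.instance Definition _ := Monoid_isCommutative.Build root_subsystem rs_mulC.

Lemma rs_mulgg (P : root_subsystem) : (P * P)%g = P.
Proof.
apply: val_inj; rewrite /= setUid.
by apply: smallest_id; exact: rsP.
Qed.

Lemma rs_act_subproof u (P : root_subsystem) :
  is_root_subsystem (geom_act u @` P).
Proof.
have /root_subsystemP[PR h] := rsP P; apply/root_subsystemP; split.
  move=> _ [b /PR [u' [s ->]] <-]; exists (u * u')%g, s.
  by rewrite geom_actM.
move=> _ _ [b Pb <-] [c Pc <-]; exists (refl b c); first exact: h.
exact: geom_act_refl.
Qed.
Definition rs_act u (P : root_subsystem) := mk_rs (rs_act_subproof u P).

Lemma rs_act1 P : rs_act 1%g P = P.
Proof.
apply/val_inj/seteqP; split=> [_ [b Pb <-]|b Pb] /=.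
  by rewrite geom_act1.
by exists b => //; rewrite geom_act1.
Qed.

Lemma rs_actM u u' P : rs_act (u * u')%g P = rs_act u (rs_act u' P).
Proof.
apply/val_inj/seteqP; split=> [_ [b Pb <-]|_ [_ [b Pb <-] <-]] /=.
  by exists (geom_act u' b); [exists b|rewrite geom_actM].
by exists b => //; rewrite geom_actM.
Qed.

Lemma rs_act_one u : rs_act u 1%g = 1%g.
Proof. by apply: val_inj; rewrite /= image_set0. Qed.

Lemma rs_actS u (P Q : root_subsystem) : P `<=` Q -> rs_act u P `<=` rs_act u Q.
Proof. by move=> PQ _ [b Pb <-]; exists b => //; exact: PQ. Qed.

Lemma rs_act_mul u (P Q : root_subsystem) :
  rs_act u (P * Q)%g = (rs_act u P * rs_act u Q)%g.
Proof.
have sub (g : U) (P' Q' : root_subsystem) :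
    (rs_act g P' * rs_act g Q')%g `<=` rs_act g (P' * Q')%g.
  have [/(_ (fun _ => id)) [hP hQ] _] := rs_mul_sub P' Q' (rs_mul P' Q').
  by apply/rs_mul_sub; split; exact: rs_actS.
apply: rs_eqP; split; last exact: sub.
have := @rs_actS u _ _ (@sub u^-1%g (rs_act u P) (rs_act u Q)).
by rewrite -!rs_actM mulVg mulgV !rs_act1.
Qed.

Definition rs_action : monoid_action U root_subsystem :=
  MonoidAction rs_act1 rs_actM rs_act_one rs_act_mul.
End GeometricRepresentation.

Section DeformedDatum.
Variables (W : coxeterSystem) (E : comMonoidType) (rho : monoid_action W E).
Variables (e : simple W -> E) (R : comPzRingType) (u : simple W -> R).

Definition e_hat (s : simple W) : monoid_alg R E :=
  1 + malg_scal E (u s - 1) * malg_elt R (e s).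

Hypothesis e_idem : forall s, (e s * e s)%g = e s.
Hypothesis e_equiv : equivariant rho e.
Hypothesis u_unit : forall s, invertible (u s).
Hypothesis u_equiv : equivariant (fun _ (r : R) => r) u.

Lemma e_hat_unit s : invertible (e_hat s).
Proof.
have [v uv] := u_unit s.
exists (1 + malg_scal E (v * (1 - u s)) * malg_elt R (e s)).
rewrite /e_hat; set x := malg_elt R _.
have xx : x * x = x by rewrite /x malg_monM mulr1 e_idem.
set a := malg_scal _ _; set b := malg_scal _ _.
have ab : b + a + a * b = 0.
  have r0 : v * (1 - u s) + (u s - 1) + (u s - 1) * (v * (1 - u s)) = 0.
    have -> : (u s - 1) * (v * (1 - u s)) = (1 - u s) - v * (1 - u s).
      by rewrite mulrA mulrBl uv mul1r mulrBl mul1r.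
    by rewrite addrC addrA subrK addrA subrK subrr.
  by rewrite /a /b -!rmorphM -!rmorphD r0 rmorph0.
rewrite mulrDl mul1r mulrDr mulr1 mulrACA xx -addrA -!mulrDl.
by rewrite addrA ab mul0r addr0.
Qed.

Lemma e_hat_equiv : equivariant (lin_action R rho) e_hat.
Proof.
move=> s1 s2 w h; rewrite /e_hat ract_add ract_one ract_mul.
have -> : lin_action R rho w (malg_scal E (u s1 - 1)) = malg_scal E (u s2 - 1).
  by rewrite -(u_equiv h); exact: lin_act_scal.
have -> // : lin_action R rho w (malg_elt R (e s1)) = malg_elt R (e s2).
by rewrite -(e_equiv h); exact: lin_actU.
Qed.

Definition hat_datum : marin_datum W R :=
  @MarinDatum W R (monoid_alg R E) (malg_scal E) (lin_action R rho)
    (@lin_act_scal R E W rho) e_hat e_hat_unit e_hat_equiv.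
End DeformedDatum.

Section Juyumaya.
Variables (K : realType) (W U : coxeterSystem).
Variables (phi : {multiplicative W -> U}) (e : simple W -> root_subsystem K U).

Lemma hom1 : phi 1%g = 1%g.
Proof. by apply: (mulgI (phi 1%g)); rewrite -gmulfM !mulg1. Qed.

(* The action rho_phi. *)
Definition phi_action : monoid_action W (root_subsystem K U).
Proof.
apply: (@MonoidAction _ _ (fun w => rs_action K U (phi w))).
- by move=> P; rewrite hom1 mact1.
- by move=> v w P; rewrite gmulfM mactM.
- by move=> w; exact: mact_one.
- by move=> w; exact: mact_mul.
Defined.

Definition is_juyumaya :=
  equivariant phi_action e /\
  forall s1 s2 w,
    generated (e s1 `|` phi_action w (e s2)) =
    generated (e s1 `|` phi_action (sgen s1 * w)%g (e s2)).

Definition Sigma_e := orbit_monoid phi_action e.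
HB.instance Definition _ := ComMonoid.on Sigma_e.

Definition Sigma_e_action : monoid_action W Sigma_e := orbit_action phi_action e.
Definition Sigma_e_map : simple W -> Sigma_e := orbit_e phi_action e.

Lemma Sigma_e_idem s : (Sigma_e_map s * Sigma_e_map s)%g = Sigma_e_map s.
Proof. by apply: val_inj; exact: rs_mulgg. Qed.

Hypothesis J : is_juyumaya.

Lemma Sigma_e_equiv : equivariant Sigma_e_action Sigma_e_map.
Proof. by move=> s1 s2 w h; apply: val_inj; exact: J.1 h. Qed.

Variables (R : comPzRingType) (u : simple W -> R).
Hypothesis u_unit : forall s, invertible (u s).
Hypothesis u_equiv : equivariant (fun _ (r : R) => r) u.

(* R[Sigma_e] with the linearly extended action and the map e_hat. *)
Definition juyumaya_datum : marin_datum W R :=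
  hat_datum Sigma_e_idem Sigma_e_equiv u_unit u_equiv.
End Juyumaya.

(* Main.v *)
(* Marin's monoid condition e_s x = e_s (s.x) is the Juyumaya condition on the
   generators w.e_t and passes to products; it gives
   (1 - a_s) c = (1 - a_s) (s.c) in A = R[Sigma], for a_s = 1 + (u_s - 1) e_s.
   By Matsumoto's theorem the A-span of the g_w is stable under the generators
   g_s and their inverses, so the g_w span.  For independence, the free
   A-module on W carries operators L_s and R_t that imitate left and right
   multiplication by g_s and g_t; the identity above makes them commute, whence
   the L_s satisfy the braid and quadratic relations, the Marin ring acts, and
   g_w sends the basis element of 1 to that of w.  "s is a left descent of w" is
   expressed by the reflection cocycle W x {reflections} -> Z/2, from which the
   exchange property follows.
   The augmentation is W-invariant and maps a_s to u_s, so it induces the map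
   onto the Hecke algebra. *)
Require Import Defs.
From HB Require Import structures.
From mathcomp Require Import all_boot all_order all_algebra.
From mathcomp Require Import boolp classical_sets reals.
Local Open Scope ring_scope.
From mathcomp Require Import monalg ring.

Set Implicit Arguments.
Unset Strict Implicit.
Unset Printing Implicit Defensive.

Import GRing.Theory.

(** * Reflection cocycle, exchange property and Matsumoto's theorem *)

Section ReflectionCocycle.
Variable W : coxeterSystem.
Implicit Types (s t : simple W) (x y z : seq (simple W)) (r w : W).
Local Open Scope group_scope.
Local Notation alt s t k := (unzip1 (alternating s t k)).

Lemma cox_prod_nil : cox_prod [::] = 1 :> W.
Proof. by rewrite /cox_prod big_nil. Qed.

Lemma cox_prod_cons s x : cox_prod (s :: x) = sgen s * cox_prod x.
Proof. by rewrite /cox_prod big_cons. Qed.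

Lemma cox_prod_cat x y : cox_prod (x ++ y) = cox_prod x * cox_prod y.
Proof. by rewrite /cox_prod big_cat. Qed.

Lemma size_alt s t k : size (alt s t k) = k.
Proof. by elim: k s t => //= k IHk s t; rewrite IHk. Qed.

(* The number mod 2 of positions i such that r is the reflection
   s_1 ... s_(i-1) s_i s_(i-1) ... s_1 of the word s_1 ... s_q. *)
Fixpoint word_parity x r : bool :=
  if x is s :: x' then (sgen s == r) (+) word_parity x' (conjg r (sgen s))
  else false.

Lemma word_parity_cat x y r :
  word_parity (x ++ y) r = word_parity x r (+) word_parity y (conjg r (cox_prod x)).
Proof.
elim: x r => [|s x IHx] r /=; first by rewrite cox_prod_nil conjg1.
by rewrite IHx cox_prod_cons conjgM addbA.
Qed.

(** Conjugation by [s] carries [(ts)^j t] to [(st)^(j+1) s], so the reflections of an alternating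
    word are the successive [(st)^j s]. *)
Lemma word_parity_alt s t k r : word_parity (alt s t k) r =
  \big[addb/false]_(0 <= j < k) ((sgen s * sgen t) ^+ j * sgen s == r).
Proof.
elim: k s t r => [|k IHk] s t r; first by rewrite big_geq.
rewrite /= IHk big_nat_recl//= expg0 mul1g; congr (_ (+) _).
apply: eq_bigr => j _; rewrite -[RHS](inj_eq (conjg_inj (sgen s))).
rewrite conjMg conjXg !conjgE sgenV !mulgA sgenK mul1g expgSr -(mulgA _ (sgen s)).
by rewrite sgenK mulg1 -!mulgA sgenK mulg1.
Qed.

(** Since [(st)^m = 1], positions [j] and [j + m] carry the same reflection, and their contributions
    cancel. *)
Lemma word_parity_order s t r :
  word_parity (alt s t (cox_m s t + cox_m s t)) r = false.
Proof.
rewrite word_parity_alt (@big_cat_nat _ _ _ (cox_m s t)) ?leq_addr//=.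
rewrite -[X in _ (+) \big[_/_]_(X <= _ < _) _]add0n big_addn addnK.
rewrite -big_split /= big1_seq// => j _.
rewrite expgnDr; have /cox_m_order -> := dvdnn (cox_m s t).
by rewrite mulg1 addbb.
Qed.

(** An equality [(ts)^j t = s] would give [(ts)^(j+1) = 1] with [0 < j+1 <= k], below the order of
    [ts]. *)
Lemma word_parity_descent s t k : ((cox_m s t == 0) || (k < cox_m s t))%N ->
  word_parity (alt t s k) (sgen s) = false.
Proof.
move=> km; rewrite word_parity_alt big1_seq// => j /=.
rewrite mem_index_iota => /andP[_ jk]; apply/negbTE/eqP => h.
have /cox_m_order : (sgen t * sgen s) ^+ j.+1 = 1.
  by rewrite expgSr mulgA h sgenK.
rewrite cox_m_sym => /dvdnP[q qE]; case/orP: km => [/eqP m0|km].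
  by rewrite m0 muln0 in qE.
case: q qE => [//|q qE].
have : (cox_m s t <= j.+1)%N by rewrite qE mulSn leq_addr.
by rewrite leqNgt (leq_ltn_trans jk km).
Qed.

Lemma coxeter_rel_alt s t k :
  unzip1 (flatten (nseq k [:: (s, true); (t, true)])) = alt s t (k + k).
Proof. by elim: k => //= k ->; rewrite addnS. Qed.

Lemma coxeter_rel_eval (x y : word (simple W)) :
  pres_eq (coxeter_rel cox_m) x y -> word_eval sgen x = word_eval sgen y.
Proof.
apply: word_eval_pres => _ _ [s [t [_ -> ->]]].
have evE n : word_eval sgen (flatten (nseq n [:: (s, true); (t, true)])) =
    (sgen s * sgen t) ^+ n.
  elim: n => [|n IHn]; first by rewrite /word_eval big_nil.
  by rewrite expgS -IHn /word_eval /= !big_cons /= mulgA.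
rewrite evE; have /cox_m_order -> := dvdnn (cox_m s t).
by rewrite /word_eval big_nil.
Qed.

(** Relators contain each reflection an even number of times, and equivalent words have the same
    product, so the conjugation in [word_parity_cat] agrees on both sides. *)
Lemma word_parity_pres (x y : word (simple W)) : pres_eq (coxeter_rel cox_m) x y ->
  word_parity (unzip1 x) =1 word_parity (unzip1 y).
Proof.
elim=> {x y} [_ _ [s [t [m0 -> ->]]]|s b|x x' y y' xx IHx yy IHy|//|
              x y _ IH|x y z _ IH1 _ IH2] r.
- by rewrite coxeter_rel_alt word_parity_order.
(* Both reflections of the word [ss] are [s], so they cancel. *)
- rewrite /= addbF conjgE sgenV; case: eqP => [<-|sr].
    by rewrite sgenK mulg1 eqxx.
  case: eqP => // h; case: sr.
  have : sgen s * sgen s = sgen s * (sgen s * (r * sgen s)) by rewrite -h.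
  by rewrite mulgA !sgenK mul1g => h1; apply: (mulIg (sgen s)); rewrite sgenK.
- rewrite /unzip1 !map_cat !word_parity_cat -!/(unzip1 _) IHx IHy.
  by rewrite !cox_prod_word (coxeter_rel_eval xx).
- by rewrite IH.
- by rewrite IH1 IH2.
Qed.

(** Completeness of the Coxeter presentation makes the parity a function on [W]. *)
Lemma word_parity_prod x y : cox_prod x = cox_prod y ->
  word_parity x =1 word_parity y.
Proof.
pose wd (z : seq (simple W)) := [seq (s, true) | s <- z].
have wdK z : unzip1 (wd z) = z by rewrite /unzip1 -map_comp map_id.
move=> xy r; rewrite -(wdK x) -(wdK y); apply: word_parity_pres.
by apply: cox_presentation; rewrite -!cox_prod_word !wdK.
Qed.

(** * The cocycle on [W] and the exchange property *)

Definition parity w r := word_parity (reduced_expr w) r.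

Lemma reduced_exprK w : cox_prod (reduced_expr w) = w.
Proof. by rewrite /reduced_expr; case: cid => x []. Qed.

Lemma reduced_expr_reduced w : reduced (reduced_expr w).
Proof. by rewrite /reduced_expr; case: cid => x []. Qed.

Lemma parity_prod x : parity (cox_prod x) =1 word_parity x.
Proof. by apply: word_parity_prod; rewrite reduced_exprK. Qed.

Lemma parityM v w r : parity (v * w) r = parity v r (+) parity w (conjg r v).
Proof.
rewrite -(reduced_exprK v) -(reduced_exprK w) -cox_prod_cat !parity_prod.
by rewrite word_parity_cat.
Qed.

Lemma parity1 r : parity 1 r = false.
Proof. by rewrite -cox_prod_nil parity_prod. Qed.

Lemma parity_sgen s r : parity (sgen s) r = (sgen s == r).
Proof.
have -> : sgen s = cox_prod [:: s] by rewrite cox_prod_cons cox_prod_nil mulg1.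
by rewrite parity_prod /= addbF cox_prod_cons cox_prod_nil mulg1.
Qed.

(** An odd count is nonzero, so [r] is the reflection at some position, and multiplying by it
    deletes the letter there. *)
Lemma word_parity_exchange x r : word_parity x r ->
  exists u s v, x = u ++ s :: v /\ r * cox_prod x = cox_prod (u ++ v).
Proof.
elim: x r => [|s x IHx] r //=; case: eqP => [<- _|_ /= /IHx].
  by exists [::], s, x; rewrite cox_prod_cons mulgA sgenK mul1g.
move=> [u [s' [v [-> h]]]]; exists (s :: u), s', v; split=> //=.
by rewrite !cox_prod_cons -h conjgE sgenV !mulgA sgenK mul1g.
Qed.

Lemma reduced_eq x y : reduced x -> cox_prod y = cox_prod x ->
  (size y <= size x)%N -> reduced y.
Proof. by move=> rx yx le z; rewrite yx => /rx; apply: leq_trans. Qed.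

Lemma reduced_behead s x : reduced (s :: x) -> reduced x.
Proof.
by move=> rx y yx; apply: (rx (s :: y)); rewrite !cox_prod_cons yx.
Qed.

(** Otherwise exchange would delete a letter of [x] and express [s x] with two letters fewer. *)
Lemma reduced_behead_parity s x :
  reduced (s :: x) -> word_parity x (sgen s) = false.
Proof.
move=> rx; apply/negP => /word_parity_exchange[u [r [v [xE h]]]].
have := rx (u ++ v); rewrite cox_prod_cons h => /(_ erefl).
by rewrite xE /= !size_cat /= addnS ltnNge leqnSn.
Qed.

Lemma reduced_parity s x : reduced (s :: x) -> word_parity (s :: x) (sgen s).
Proof.
move=> rx; rewrite /= eqxx conjgE sgenK mulg1 sgenV.
by rewrite reduced_behead_parity.
Qed.

(** Multiplication by [s] flips the parity at [s], so exchange deletes a letter from any expression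
    of [sw] and leaves an expression of [w]. *)
Lemma reduced_cons s w : parity w (sgen s) = false -> reduced (s :: reduced_expr w).
Proof.
move=> ws y; rewrite cox_prod_cons reduced_exprK => yE.
have /word_parity_exchange[u [r [v [yuv h]]]] : word_parity y (sgen s).
  rewrite -parity_prod yE parityM parity_sgen eqxx conjgE sgenK mulg1.
  by rewrite sgenV ws.
have : cox_prod (u ++ v) = w by rewrite -h yE mulgA sgenK mul1g.
rewrite -[w in _ = w]reduced_exprK => /reduced_expr_reduced.
by rewrite yuv !size_cat /= addnS.
Qed.

Lemma reduced_descent s w : parity w (sgen s) ->
  exists x, [/\ cox_prod x = sgen s * w, reduced x & reduced (s :: x)].
Proof.
move=> /word_parity_exchange[u [r [v [wE h]]]].
exists (u ++ v); rewrite -h reduced_exprK.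
suff rx : reduced (s :: u ++ v) by split=> //; exact: reduced_behead rx.
apply: (reduced_eq (@reduced_expr_reduced w)); last first.
  by rewrite [in leqRHS]wE /= !size_cat /= addnS.
by rewrite cox_prod_cons -h mulgA sgenK mul1g.
Qed.

(** The prefix grows on the left, with [s] and [t] swapped at each induction step. With [k = m] it
    links reduced words that have different first letters. *)
Lemma reduced_alt_prefix k s t x y :
  reduced (s :: x) -> reduced (t :: y) -> cox_prod (s :: x) = cox_prod (t :: y) ->
  ((cox_m s t == 0) || (k <= cox_m s t))%N ->
  exists z, cox_prod (alt s t k ++ z) = cox_prod (s :: x) /\
    reduced (alt s t k ++ z).
Proof.
elim: k s t x y => [|k IHk] s t x y rx ry xy km; first by exists (s :: x).
have [|z [zE rz]] := IHk t s y x ry rx (esym xy).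
  by rewrite cox_m_sym; case/orP: km => [->|/ltnW ->] //; rewrite orbT.
(* As [k < m] or [m] is infinite, the alternating prefix contributes nothing at [s]. The letter
   exchanged against the new [s] therefore lies in [z], and the prefix survives. *)
have := word_parity_prod (etrans zE (esym xy)) (sgen s).
rewrite word_parity_cat word_parity_descent // (reduced_parity rx) /=.
move=> /word_parity_exchange[u [r [v [zuv h]]]].
have pE : cox_prod ((s :: alt t s k) ++ (u ++ v)) = cox_prod (s :: x).
  rewrite cat_cons cox_prod_cons cox_prod_cat -h conjgE !mulgA mulgK sgenK.
  by rewrite mul1g -cox_prod_cat zE -xy.
exists (u ++ v); split=> //; apply: (reduced_eq rz); first by rewrite pE xy zE.
by rewrite zuv /= !size_cat /= !size_alt !addnS.
Qed.

(** * Positive words in the braid group and Matsumoto's theorem *)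

Definition braid_prod x : braid_group W := \prod_(s <- x) braid_gen s.

Lemma braid_prod_cons s x : braid_prod (s :: x) = braid_gen s * braid_prod x.
Proof. by rewrite /braid_prod big_cons. Qed.

Lemma braid_prod_alt s t k :
  braid_prod (alt s t k) = pres_class (@braid_rel W) (alternating s t k).
Proof.
elim: k s t => [|k IHk] s t; first by rewrite /braid_prod big_nil.
by rewrite braid_prod_cons IHk -pres_classM.
Qed.

(** Induction on length. Equal first letters reduce to the tails. Distinct first letters [s], [t]
    are compared through two words with alternating prefixes of length [m] and a common tail, which
    differ by one braid relation. *)
Lemma matsumoto x y : reduced x -> reduced y -> cox_prod x = cox_prod y ->
  braid_prod x = braid_prod y.
Proof.
have [n] := ubnP (size x); elim: n x y => // n IHn [|s x] y.
  by move=> _ _ /(_ [::]) ry xy; case: y ry xy => // t y ry /ry.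
case: y => [_ /(_ [::]) rx _ /esym/rx //|t y].
rewrite ltnS => sx rx ry xy; rewrite !braid_prod_cons.
have IH q u z : reduced (q :: u) -> reduced (q :: z) ->
    cox_prod (q :: u) = cox_prod (q :: z) -> (size u < n)%N ->
    braid_prod u = braid_prod z.
  move=> ru rz; rewrite !cox_prod_cons => /mulgI uz un; apply: IHn => //.
    exact: reduced_behead ru.
  exact: reduced_behead rz.
have syx : (size y <= size x)%N by exact: ry xy.
case: (pselect (s = t)) => [st|st].
  by rewrite st (@IH t x y)// -[t in t :: x]st.
have m_gt0 : (0 < cox_m s t)%N.
  rewrite lt0n; apply/eqP => m0.
  (* If [m] were infinite, this prefix alone would be one letter longer than the reduced word
     [s :: x]. *)
  have [|z [zE rz]] := @reduced_alt_prefix (size x).+2 s t x y rx ry xy.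
    by rewrite m0.
  by have := rz _ (esym zE); rewrite size_cat size_alt /= ltnNge leq_addr.
have [|z [zE rz]] := @reduced_alt_prefix (cox_m s t) s t x y rx ry xy.
  by rewrite leqnn orbT.
have altE : cox_prod (alt s t (cox_m s t)) = cox_prod (alt t s (cox_m s t)).
  by rewrite !cox_prod_word; apply: braid_rel_eval; exists s, t.
have rz' : reduced (alt t s (cox_m s t) ++ z).
  apply: (reduced_eq rz); first by rewrite !cox_prod_cat altE.
  by rewrite !size_cat !size_alt.
have zE' : cox_prod (alt t s (cox_m s t) ++ z) = cox_prod (t :: y).
  by rewrite cox_prod_cat -altE -cox_prod_cat zE.
have braidE : braid_prod (alt s t (cox_m s t)) = braid_prod (alt t s (cox_m s t)).
  rewrite !braid_prod_alt; apply/pres_classP/pres_rel.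
  by exists s, t.
have bcat u v : braid_prod (u ++ v) = braid_prod u * braid_prod v.
  by rewrite /braid_prod big_cat.
(* Writing [m] as a successor exposes the first letters [s] and [t] of the alternating words, as the
   induction hypothesis requires. *)
move: m_gt0 zE rz rz' zE' braidE; case: (cox_m s t) => // m _ /= zE rz rz' zE' bE.
rewrite (IH s _ _ rx rz (esym zE))// (IH t _ _ ry rz' (esym zE')); last first.
  exact: leq_ltn_trans syx sx.
by rewrite -!braid_prod_cons -!cat_cons !bcat bE.
Qed.

Lemma braid_lift_reduced x : reduced x -> braid_lift (cox_prod x) = braid_prod x.
Proof.
move=> rx; apply: matsumoto => //; first exact: reduced_expr_reduced.
exact: reduced_exprK.
Qed.
End ReflectionCocycle.

(** * The regular module of the Marin ring *)

Section AdditiveMaps.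
Variables (K : choiceType) (A Z : zmodType).

Lemma morphD0 (f : {malg A[K]} -> Z) : {morph f : x y / x + y} -> f 0 = 0.
Proof. by move=> fD; apply: (addIr (f 0)); rewrite -fD !add0r. Qed.

Lemma eq_malg_morphD (f g : {malg A[K]} -> Z) :
  {morph f : x y / x + y} -> {morph g : x y / x + y} ->
  (forall k c, f << c *g k >> = g << c *g k >>) -> f =1 g.
Proof.
move=> fD gD fg; elim/malg_ind => [|k c|x y IHx IHy]; first by rewrite !morphD0.
  exact: fg.
by rewrite fD gD IHx IHy.
Qed.
End AdditiveMaps.

(* Proved over an abstract ring, where rewriting does not unfold the product. *)
Section AdditiveAction.
Variables (S : pzRingType) (Z : zmodType) (op : S -> Z -> Z).
Hypothesis opDl : forall x y f, op (x + y) f = op x f + op y f.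
Hypothesis opDr : forall x f g, op x (f + g) = op x f + op x g.

Lemma action_0l f : op 0 f = 0.
Proof. by apply: (addIr (op 0 f)); rewrite -opDl !add0r. Qed.

Lemma action_0r x : op x 0 = 0.
Proof. by apply: (addIr (op x 0)); rewrite -opDr !add0r. Qed.

Lemma action_Nl x f : op (- x) f = - op x f.
Proof. by apply: (addIr (op x f)); rewrite -opDl !addNr action_0l. Qed.

Lemma action_Bl x y f : op (x - y) f = op x f - op y f.
Proof. by rewrite opDl action_Nl. Qed.

(** [Pgen] says, as an induction principle, that [P] generates [S] additively. *)
Lemma action_mul (P : S -> Prop) :
  (forall Q : S -> Prop, Q 0 -> (forall x, P x -> Q x) ->
     (forall x y, Q x -> Q y -> Q (x + y)) -> forall x, Q x) ->
  (forall x y f, P x -> P y -> op (x * y) f = op x (op y f)) ->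
  forall x y f, op (x * y) f = op x (op y f).
Proof.
move=> Pgen PM x y f; elim/Pgen: x => [|x Px|x x' IHx IHx'].
- by rewrite mul0r !action_0l.
- elim/Pgen: y => [|y Py|y y' IHy IHy'].
  + by rewrite mulr0 !action_0l action_0r.
  + exact: PM.
  + by rewrite mulrDr !opDl opDr IHy IHy'.
- by rewrite mulrDl !opDl IHx IHx'.
Qed.

Hypothesis opM : forall x y f, op (x * y) f = op x (op y f).

Lemma action_ideal (X : set S) : (forall x f, X x -> op x f = 0) ->
  forall x f, ideal_gen X x -> op x f = 0.
Proof.
move=> X0 x f xI.
elim: xI f => {x} [x Xx||x y _ IHx _ IHy|b x _ IHx|x b _ IHx] f.
- exact: X0.
- exact: action_0l.
- by rewrite opDl IHx IHy addr0.
- by rewrite opM IHx action_0r.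
- by rewrite opM IHx.
Qed.

Lemma action_quadratic g b c (lg lb lc : Z -> Z) f :
  op g =1 lg -> op b =1 lb -> op c =1 lc -> lg (lg f) = lb f + lc (lg f) ->
  op (g ^+ 2 - b - c * g) f = 0.
Proof.
move=> gE bE cE q; rewrite !action_Bl expr2 !opM !gE bE cE q.
by rewrite [X in X - _]addrAC subrr add0r subrr.
Qed.
End AdditiveAction.

Section HeckeModule.
Variables (W : coxeterSystem) (k : comPzRingType) (D : marin_datum W k).
Local Notation A := (md_alg D).
Local Notation a := (md_a D).
Local Notation act := (md_act D).
Hypothesis a_act : forall s c, (1 - a s) * c = (1 - a s) * act (sgen s) c.
Implicit Types (s t : simple W) (w : W) (c : A).

Local Notation F := {malg A[W]}.
Implicit Type f : F.

Definition malg_lscale c f : F := malg_ext (fun w b => << c * b *g w >>) f.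

Lemma malg_lscaleD c : {morph malg_lscale c : f g / f + g}.
Proof. by move=> f g; apply: malg_extD => w b b'; rewrite mulrDr monalgUD. Qed.

Lemma malg_lscaleU c b w : malg_lscale c << b *g w >> = << c * b *g w >>.
Proof. by apply: malg_extU => v b1 b2; rewrite mulrDr monalgUD. Qed.

Lemma malg_lscaleA b c f : malg_lscale b (malg_lscale c f) = malg_lscale (b * c) f.
Proof.
elim/malg_ind: f => [|w d|f g IHf IHg].
- by rewrite !(morphD0 (@malg_lscaleD _)).
- by rewrite !malg_lscaleU mulrA.
- by rewrite !malg_lscaleD IHf IHg.
Qed.

Lemma malg_lscale1 f : malg_lscale 1 f = f.
Proof.
elim/malg_ind: f => [|w d|f g IHf IHg].
- by rewrite !(morphD0 (@malg_lscaleD _)).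
- by rewrite !malg_lscaleU mul1r.
- by rewrite !malg_lscaleD IHf IHg.
Qed.

Lemma malg_lscaleDl b c f :
  malg_lscale (b + c) f = malg_lscale b f + malg_lscale c f.
Proof.
rewrite /malg_lscale -malg_ext_split; apply: eq_malg_ext => w d.
by rewrite mulrDl monalgUD.
Qed.

Lemma act_a s : act (sgen s) (a s) = a s.
Proof. by apply: md_a_equiv; rewrite mulgK. Qed.

(** The coefficients of [g_(sw)] and [g_w] in [g_s g_w]: at a descent [g_w = g_s g_(sw)], and the
    quadratic relation gives [a_s g_(sw) + (1 - a_s) g_w]. The last two functions do the same for
    [g_w g_t]. *)
Definition hecke_p s w := if parity w (sgen s) then a s else 1.
Definition hecke_q s w := if parity w (sgen s) then 1 - a s else 0.
Definition hecke_pr t w := if parity w^-1%g (sgen t) then act w (a t) else 1.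
Definition hecke_qr t w := if parity w^-1%g (sgen t) then 1 - act w (a t) else 0.

(* Left multiplication by g_s, written in the basis g_w: [parity w (sgen s)]
   says that s is a left descent of w. *)
Definition hecke_l s f : F := malg_ext (fun w c =>
  << act (sgen s) c * hecke_p s w *g (sgen s * w)%g >> +
  << act (sgen s) c * hecke_q s w *g w >>) f.

(* Right multiplication by g_t: when wt < w, moving the coefficients of
   g_t^2 = a_t + (1 - a_t) g_t to the left across g_(wt) gives w.a_t. *)
Definition hecke_r t f : F := malg_ext (fun w c =>
  << c * hecke_pr t w *g (w * sgen t)%g >> + << c * hecke_qr t w *g w >>) f.

Let hecke_l_add s w b c :
  << act (sgen s) (b + c) * hecke_p s w *g (sgen s * w)%g >> +
  << act (sgen s) (b + c) * hecke_q s w *g w >> =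
  (<< act (sgen s) b * hecke_p s w *g (sgen s * w)%g >> +
   << act (sgen s) b * hecke_q s w *g w >>) +
  (<< act (sgen s) c * hecke_p s w *g (sgen s * w)%g >> +
   << act (sgen s) c * hecke_q s w *g w >>) :> F.
Proof. by rewrite ract_add !mulrDl !monalgUD addrACA. Qed.

Let hecke_r_add t w b c :
  << (b + c) * hecke_pr t w *g (w * sgen t)%g >> +
  << (b + c) * hecke_qr t w *g w >> =
  (<< b * hecke_pr t w *g (w * sgen t)%g >> + << b * hecke_qr t w *g w >>) +
  (<< c * hecke_pr t w *g (w * sgen t)%g >> + << c * hecke_qr t w *g w >>) :> F.
Proof. by rewrite !mulrDl !monalgUD addrACA. Qed.

Lemma hecke_lD s : {morph hecke_l s : f g / f + g}.
Proof. by move=> f g; apply: malg_extD; exact: hecke_l_add. Qed.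

Lemma hecke_lU s w c : hecke_l s << c *g w >> =
  << act (sgen s) c * hecke_p s w *g (sgen s * w)%g >> +
  << act (sgen s) c * hecke_q s w *g w >>.
Proof. by apply: malg_extU; exact: hecke_l_add. Qed.

Lemma hecke_rD t : {morph hecke_r t : f g / f + g}.
Proof. by move=> f g; apply: malg_extD; exact: hecke_r_add. Qed.

Lemma hecke_rU t w c : hecke_r t << c *g w >> =
  << c * hecke_pr t w *g (w * sgen t)%g >> + << c * hecke_qr t w *g w >>.
Proof. by apply: malg_extU; exact: hecke_r_add. Qed.

Lemma hecke_l_scale s c f :
  hecke_l s (malg_lscale c f) = malg_lscale (act (sgen s) c) (hecke_l s f).
Proof.
elim/malg_ind: f => [|w d|f g IHf IHg].
- by rewrite !(morphD0 (@malg_lscaleD _), morphD0 (@hecke_lD _)).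
- by rewrite malg_lscaleU !hecke_lU malg_lscaleD !malg_lscaleU ract_mul !mulrA.
- by rewrite !(malg_lscaleD, hecke_lD) IHf IHg.
Qed.

Lemma parity_sgenM s w : parity (sgen s * w)%g (sgen s) = ~~ parity w (sgen s).
Proof. by rewrite parityM parity_sgen eqxx conjgE sgenK mulg1 sgenV. Qed.

Lemma act_1B w c : act w (1 - c) = 1 - act w c.
Proof. by apply: (addIr (act w c)); rewrite -ract_add !subrK ract_one. Qed.

Lemma act_1a s : act (sgen s) (1 - a s) = 1 - a s.
Proof. by rewrite act_1B act_a. Qed.

(** On [c w] the two sides differ only by [c] against [s.c] in terms with a factor [1 - a_s], and
    [a_act] identifies these. *)
Lemma hecke_l_quadratic s f : hecke_l s (hecke_l s f) =
  malg_lscale (a s) f + malg_lscale (1 - a s) (hecke_l s f).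
Proof.
elim/malg_ind: f => [|w c|f g IHf IHg]; last 1 first.
- by rewrite !(malg_lscaleD, hecke_lD) IHf IHg addrACA.
- by rewrite !(morphD0 (@malg_lscaleD _), morphD0 (@hecke_lD _)) addr0.
rewrite !(hecke_lU, hecke_lD, malg_lscaleD, malg_lscaleU) !ract_mul.
rewrite -!ractM !sgenK ract1 mulgA sgenK mul1g.
rewrite /hecke_p /hecke_q parity_sgenM; case: (parity w (sgen s)) => /=.
  rewrite act_a act_1a !(mulr0, monalgU0, addr0) mulr1 !mulrA -a_act.
  move: (a s) => x.
  have -> : c * (1 - x) * x = (1 - x) * c * x by ring.
  have -> : c * (1 - x) * (1 - x) = (1 - x) * c * (1 - x) by ring.
  by rewrite (mulrC x).
rewrite ract_one ract0 !(mulr0, mul0r, monalgU0, addr0, mulr1) -a_act.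
by rewrite [c * a s]mulrC [c * (1 - _)]mulrC.
Qed.

Lemma hecke_q_act s w c : hecke_q s w * c = hecke_q s w * act (sgen s) c.
Proof. by rewrite /hecke_q; case: ifP => _; rewrite ?mul0r -?a_act. Qed.

Lemma parity_mulr s t w : (w * sgen t)%g <> (sgen s * w)%g ->
  parity (w * sgen t)%g (sgen s) = parity w (sgen s).
Proof.
move=> wt; rewrite parityM parity_sgen; case: eqP => [h|_]; last by rewrite addbF.
by case: wt; rewrite h conjgE mulVKg.
Qed.

(** If [wt = sw], then [w.a_t = a_s] and [s] is a left descent of [w] exactly when [t] is a right
    descent, so the formulas coincide. Otherwise neither multiplication affects the descent
    condition of the other. *)
Lemma hecke_lr s t f : hecke_l s (hecke_r t f) = hecke_r t (hecke_l s f).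
Proof.
elim/malg_ind: f => [|w c|f g IHf IHg]; last 1 first.
- by rewrite !(hecke_rD, hecke_lD) IHf IHg.
- by rewrite !(morphD0 (@hecke_rD _), morphD0 (@hecke_lD _)).
rewrite !(hecke_lU, hecke_rU, hecke_lD, hecke_rD) !ract_mul -!mulrA -mulgA.
set b := act (sgen s) c; case: (pselect (w * sgen t = sgen s * w)%g) => [wt|wt].
  have tE : conjg (sgen s) w = sgen t by rewrite conjgE -wt mulKg.
  have aE : act w (a t) = a s by apply: md_a_equiv; rewrite wt mulgK.
  have parE : parity w^-1%g (sgen t) = parity w (sgen s).
    (* The cocycle identity for [w w^-1 = 1] at [s] equates the two descent conditions. *)
    have := parity1 (sgen s); rewrite -(mulgV w) parityM tE.
    by case: (parity w _); case: (parity _ _).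
  have parE' : parity (sgen s * w)^-1%g (sgen t) = ~~ parity w (sgen s).
    by rewrite invgM sgenV parityM parE parity_sgen -tE conjgK eqxx addbT.
  rewrite /hecke_p /hecke_q /hecke_pr /hecke_qr wt parE parE' parity_sgenM.
  rewrite ractM aE act_a.
  by case: (parity w (sgen s)); rewrite /= ?ract_one ?ract0 ?act_a ?act_1a.
have pE : hecke_p s (w * sgen t)%g = hecke_p s w.
  by rewrite /hecke_p parity_mulr.
have qE : hecke_q s (w * sgen t)%g = hecke_q s w.
  by rewrite /hecke_q parity_mulr.
have parE : parity (sgen s * w)^-1%g (sgen t) = parity w^-1%g (sgen t).
  rewrite invgM sgenV parity_mulr// => h; case: wt.
  by apply: (mulIg w^-1%g); rewrite mulgK -mulgA -h mulgA mulgV mul1g.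
have prE : hecke_pr t (sgen s * w)%g = act (sgen s) (hecke_pr t w).
  by rewrite /hecke_pr parE ractM; case: ifP => //; rewrite ract_one.
have qrE : hecke_qr t (sgen s * w)%g = act (sgen s) (hecke_qr t w).
  rewrite /hecke_qr parE; case: ifP => _; last by rewrite ract0.
  by rewrite act_1B ractM.
(* What remains is a twist by [s] on right coefficients multiplied by [hecke_q], which absorbs
   it. *)
rewrite pE qE prE qrE ![act _ _ * hecke_p s w]mulrC addrACA.
by rewrite ![act _ _ * hecke_q s w]mulrC -!hecke_q_act.
Qed.

Lemma malg_lscale0 f : malg_lscale 0 f = 0.
Proof. by apply: (addIr (malg_lscale 0 f)); rewrite -malg_lscaleDl !add0r. Qed.

Definition a_inv s : A := sval (cid (md_a_unit D s)).

Lemma mul_a_inv s : a s * a_inv s = 1.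
Proof. exact: (svalP (cid (md_a_unit D s))). Qed.

(** The quadratic relation solved for the inverse: [g_s^-1 = a_s^-1 (g_s + a_s - 1)]. *)
Definition hecke_lV s f : F :=
  malg_lscale (a_inv s) (hecke_l s f + malg_lscale (a s - 1) f).

Lemma hecke_lVD s : {morph hecke_lV s : f g / f + g}.
Proof.
move=> f g; rewrite /hecke_lV hecke_lD (malg_lscaleD (_ - _)) addrACA.
exact: malg_lscaleD.
Qed.

Lemma hecke_lK s : cancel (hecke_l s) (hecke_lV s).
Proof.
move=> f; rewrite /hecke_lV hecke_l_quadratic -addrA -malg_lscaleDl.
rewrite addrA subrK subrr malg_lscale0 addr0 malg_lscaleA mulrC mul_a_inv.
exact: malg_lscale1.
Qed.

Lemma hecke_lVK s : cancel (hecke_lV s) (hecke_l s).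
Proof.
move=> f; rewrite /hecke_lV hecke_l_scale hecke_lD hecke_l_scale.
rewrite -opprB -mulN1r ract_mul act_1a.
have -> : act (sgen s) (- 1) = - 1.
  apply: (addIr 1); rewrite addNr -{2}(ract_one act (sgen s)) -ract_add.
  by rewrite addNr ract0.
rewrite mulN1r opprB hecke_l_quadratic -addrA -malg_lscaleDl.
rewrite addrA subrK subrr malg_lscale0 addr0 malg_lscaleA -[a s]act_a.
by rewrite -ract_mul mulrC mul_a_inv ract_one malg_lscale1.
Qed.

Lemma hecke_lV_scale s c f :
  hecke_lV s (malg_lscale c f) = malg_lscale (act (sgen s) c) (hecke_lV s f).
Proof.
apply: (can_inj (@hecke_lK s)); rewrite hecke_lVK hecke_l_scale hecke_lVK.
by rewrite -ractM sgenK ract1.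
Qed.

(** * The braid group action on the regular module *)

Definition word_op (x : word (simple W)) f : F :=
  foldr (fun l => if l.2 then hecke_l l.1 else hecke_lV l.1) f x.

Lemma word_op_cat x y f : word_op (x ++ y) f = word_op x (word_op y f).
Proof. exact: foldr_cat. Qed.

Lemma word_opD x : {morph word_op x : f g / f + g}.
Proof.
move=> f g; elim: x => //= -[s []] x -> /=; first exact: hecke_lD.
exact: hecke_lVD.
Qed.

Lemma word_op_scale x c f : word_op x (malg_lscale c f) =
  malg_lscale (act (word_eval sgen x) c) (word_op x f).
Proof.
elim: x => [|[s []] x IHx] /=; first by rewrite /word_eval big_nil ract1.
  by rewrite IHx hecke_l_scale -ractM /word_eval big_cons.
by rewrite IHx hecke_lV_scale -ractM /word_eval big_cons /= sgenV.
Qed.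

Lemma hecke_l_up s w c : parity w (sgen s) = false ->
  hecke_l s << c *g w >> = << act (sgen s) c *g (sgen s * w)%g >>.
Proof.
move=> ws; rewrite hecke_lU /hecke_p /hecke_q ws mulr1 mulr0 monalgU0.
exact: addr0.
Qed.

(** Up to length [m] every new letter is an ascent, so no term with [hecke_q] appears. *)
Lemma word_op_alt s t n c : ((cox_m s t == 0) || (n <= cox_m s t))%N ->
  word_op (alternating s t n) << c *g 1%g >> =
  << act (word_eval sgen (alternating s t n)) c
     *g word_eval sgen (alternating s t n) >>.
Proof.
elim: n s t => [|n IHn] s t nm /=; first by rewrite /word_eval big_nil ract1.
rewrite IHn; last first.
  by rewrite cox_m_sym; case/orP: nm => [->|/ltnW ->] //; rewrite orbT.
rewrite hecke_l_up; first by rewrite -ractM /word_eval big_cons.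
by rewrite -cox_prod_word parity_prod word_parity_descent.
Qed.

Lemma word_op_hecke_r s t r n f : word_op (alternating s t n) (hecke_r r f) =
  hecke_r r (word_op (alternating s t n) f).
Proof. by elim: n s t => //= n IHn s t; rewrite IHn hecke_lr. Qed.

(* Since left and right operators commute and the right ones generate the module
   from the line A.1, a relation between left operators need only be checked on
   that line, where both sides of a braid relation go up in length. *)
Lemma word_op_braid x y : braid_rel x y -> word_op x =1 word_op y.
Proof.
move=> xy f; have xyE := braid_rel_eval xy.
case: xy xyE => s [t [_ m0 -> ->]]; set m := cox_m s t => stE.
apply: eq_malg_morphD f => [||w c]; [exact: word_opD|exact: word_opD|].
rewrite -(reduced_exprK w).
elim/last_ind: (reduced_expr w) c => [|x' r IHx] c.
  rewrite cox_prod_nil !word_op_alt ?stE// /m ?leqnn ?orbT//.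
  by rewrite (cox_m_sym s t) leqnn orbT.
set v := cox_prod x' in IHx.
have -> : cox_prod (rcons x' r) = (v * sgen r)%g.
  by rewrite -cats1 cox_prod_cat cox_prod_cons cox_prod_nil mulg1.
(* The coefficient is [1] or the unit [v.a_r], so the basis element of [vr] is recovered from
   [hecke_r r] on the line of [v], whether or not [vr] is longer than [v]. *)
have [b bE] : exists b, hecke_pr r v * b = 1.
  rewrite /hecke_pr; case: ifP => _; last by exists 1; rewrite mulr1.
  by exists (act v (a_inv r)); rewrite -ract_mul mul_a_inv ract_one.
have -> : << c *g (v * sgen r)%g >> = hecke_r r << c * b *g v >> -
    << c * b * hecke_qr r v *g v >>.
  by rewrite hecke_rU -[c * b * _]mulrA [b * _]mulrC bE mulr1 addrK.
rewrite -monalgUN !word_opD !word_op_hecke_r.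
by rewrite IHx IHx.
Qed.

Lemma word_op_pres x y : pres_eq (@braid_rel W) x y -> word_op x =1 word_op y.
Proof.
elim=> {x y} [x y xy|s b|x x' y y' _ IHx _ IHy|//|
              x y _ IH|x y z _ IH1 _ IH2] f /=.
- exact: word_op_braid.
- by case: b; [exact: hecke_lVK|exact: hecke_lK].
- by rewrite !word_op_cat IHy IHx.
- by rewrite IH.
- by rewrite IH1 IH2.
Qed.

Definition braid_op (g : braid_group W) f : F := word_op (repr g) f.

Lemma braid_op_class x : braid_op (pres_class (@braid_rel W) x) =1 word_op x.
Proof. exact/word_op_pres/pres_repr. Qed.

Lemma braid_op1 f : braid_op 1%g f = f.
Proof. exact: braid_op_class. Qed.

Lemma braid_opM g h f : braid_op (g * h)%g f = braid_op g (braid_op h f).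
Proof.
rewrite -(pres_reprK g) -(pres_reprK h) -pres_classM !braid_op_class.
exact: word_op_cat.
Qed.

Lemma braid_op_gen s f : braid_op (braid_gen s) f = hecke_l s f.
Proof. exact: braid_op_class. Qed.

Lemma braid_opD g : {morph braid_op g : f f' / f + f'}.
Proof. exact: word_opD. Qed.

Lemma braid_op_scale g c f : braid_op g (malg_lscale c f) =
  malg_lscale (act (braid_proj g) c) (braid_op g f).
Proof. exact: word_op_scale. Qed.

Lemma braid_op_lift w : braid_op (braid_lift w) << 1 *g 1%g >> = << 1 *g w >>.
Proof.
rewrite -{2}(reduced_exprK w) /braid_lift.
elim: (reduced_expr w) (@reduced_expr_reduced W w) => [|s x IHx] rx.
  by rewrite big_nil braid_op1 cox_prod_nil.
rewrite big_cons braid_opM IHx; last exact: reduced_behead rx.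
rewrite braid_op_gen hecke_l_up ?ract_one ?cox_prod_cons//.
by rewrite parity_prod (reduced_behead_parity rx).
Qed.

(** * The action of the semidirect product and of the defining ideal *)

Definition skew_op (x : braid_skew D) f : F :=
  malg_ext (fun g c => malg_lscale c (braid_op g f)) x.

Lemma skew_op_Dl (x y : braid_skew D) f :
  skew_op (x + y) f = skew_op x f + skew_op y f.
Proof. by apply: malg_extD => g b c; rewrite malg_lscaleDl. Qed.

Lemma skew_op_U g c f :
  skew_op (skew_mon (braid_action D) c g) f = malg_lscale c (braid_op g f).
Proof. by apply: malg_extU => h b d; rewrite malg_lscaleDl. Qed.

Lemma skew_op_in c f : skew_op (skew_in c : braid_skew D) f = malg_lscale c f.
Proof. by rewrite skew_op_U braid_op1. Qed.

Lemma skew_op_braid g f : skew_op (skew_braid D g) f = braid_op g f.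
Proof. by rewrite skew_op_U malg_lscale1. Qed.

Lemma skew_op_Dr x f g : skew_op x (f + g) = skew_op x f + skew_op x g.
Proof.
rewrite /skew_op -malg_ext_split; apply: eq_malg_ext => h c.
by rewrite braid_opD malg_lscaleD.
Qed.

(** On monomials this is the semilinearity [braid_op_scale], which mirrors [g c = (pi(g).c) g]. *)
Lemma skew_opM (x y : braid_skew D) f : skew_op (x * y) f = skew_op x (skew_op y f).
Proof.
apply: (action_mul skew_op_Dl skew_op_Dr
  (P := fun x => exists c g, x = skew_mon (braid_action D) c g)) => [Q Q0 QU QD|].
  by apply: malg_ind => // g c; apply: QU; exists c, g.
move=> _ _ {}f [c [g ->]] [b [h ->]].
by rewrite skew_monM !skew_op_U braid_opM braid_op_scale malg_lscaleA.
Qed.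

(** The relators act by zero by [hecke_l_quadratic], so congruent elements act alike. *)
Lemma skew_op_ideal (x : braid_skew D) f :
  ideal_gen (@marin_rel W k D) x -> skew_op x f = 0.
Proof.
apply: (action_ideal skew_op_Dl skew_op_Dr skew_opM) => {x}_ {}f [s ->].
apply: (action_quadratic skew_op_Dl skew_opM (lg := hecke_l s)).
- by move=> h; rewrite skew_op_braid braid_op_gen.
- exact: skew_op_in.
- exact: skew_op_in.
- exact: hecke_l_quadratic.
Qed.
End HeckeModule.

(** * The standard basis *)

(** Multiplying [G G = c + q G] by [V] gives [G - q = c V]. It is applied with [G = g_s],
    [V = g_s^-1] and [c = a_s]. *)
Lemma quadratic_inverse (S : pzRingType) (V G c q q' v x : S) :
  V * G = 1 -> G * G = c + q * G -> q + q' = 0 ->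
  V * c = c * V -> V * q = q * V -> v * c = 1 ->
  V * x = v * (G * x + q' * x).
Proof.
move=> VG GG qq' Vc Vq vc; have GE : G + q' = c * V.
  rewrite -[G]mul1r -VG -mulrA GG mulrDr mulrA Vc Vq -mulrA VG mulr1.
  by rewrite -addrA qq' addr0.
by rewrite -mulrDl GE !mulrA vc mul1r.
Qed.

Section MarinBasis.
Variables (W : coxeterSystem) (k : comPzRingType) (D : marin_datum W k).
Local Notation A := (md_alg D).
Local Notation a := (md_a D).
Local Notation act := (md_act D).
Hypothesis a_act : forall s b, (1 - a s) * b = (1 - a s) * act (sgen s) b.
Implicit Types (s t : simple W) (w : W) (b : A) (c d : {malg A[W]}).
Implicit Types g h : braid_group W.

Lemma marin_braid1 : marin_braid D 1%g = 1.
Proof. by []. Qed.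

Lemma marin_braidM g h :
  marin_braid D (g * h)%g = marin_braid D g * marin_braid D h.
Proof. by rewrite /marin_braid -rmorphM /skew_braid skew_monM ract_one mulr1. Qed.

Lemma marin_braid_in g b :
  marin_braid D g * marin_in D b =
  marin_in D (act (braid_proj g) b) * marin_braid D g.
Proof.
rewrite /marin_braid /marin_in -!rmorphM /skew_braid /skew_in !skew_monM.
by rewrite mul1r ract_one mulr1 mulg1 mul1g.
Qed.

Lemma marin_in0 : marin_in D 0 = 0.
Proof. by apply: (addIr (marin_in D 0)); rewrite -marin_inD !add0r. Qed.

Lemma marin_skew_mon b g :
  rq_class (@marin_rel W k D) (skew_mon (braid_action D) b g) =
  marin_in D b * marin_braid D g.
Proof.
rewrite /marin_braid /marin_in -rmorphM /skew_braid /skew_in skew_monM.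
by rewrite mul1g ract1 mulr1.
Qed.

Lemma marin_ind (P : marin_ring D -> Prop) :
  P 0 -> (forall b g, P (marin_in D b * marin_braid D g)) ->
  (forall x y, P x -> P y -> P (x + y)) -> forall x, P x.
Proof.
move=> P0 PU PD x; rewrite -(rq_reprK x).
have QD (y z : braid_skew D) : P (rq_class (@marin_rel W k D) y) ->
    P (rq_class (@marin_rel W k D) z) -> P (rq_class (@marin_rel W k D) (y + z)).
  by rewrite rmorphD; exact: PD.
by elim/malg_ind: (repr x) => [|g b|y z] //; [rewrite marin_skew_mon|exact: QD].
Qed.

Lemma marin_quadratic s : marin_braid D (braid_gen s) * marin_braid D (braid_gen s) =
  marin_in D (a s) + marin_in D (1 - a s) * marin_braid D (braid_gen s).
Proof.
rewrite /marin_braid /marin_in -!rmorphM -rmorphD; apply/rq_classP.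
by rewrite opprD addrA; apply: ideal_mem; exists s; rewrite expr2.
Qed.

Definition marin_comb c : marin_ring D :=
  malg_ext (fun w b => marin_in D b * marin_braid D (braid_lift w)) c.

Lemma marin_combD : {morph marin_comb : c d / c + d}.
Proof. by move=> c d; apply: malg_extD => w b b'; rewrite marin_inD mulrDl. Qed.

Lemma marin_combU w b :
  marin_comb << b *g w >> = marin_in D b * marin_braid D (braid_lift w).
Proof. by apply: malg_extU => v b' b''; rewrite marin_inD mulrDl. Qed.

(** A combination lifts to the semidirect product, where its action on the basis element of [1]
    returns its coefficients. Two lifts with the same class act alike. *)
Lemma marin_comb_inj : injective marin_comb.
Proof.
pose lift c : braid_skew D :=
  malg_ext (fun w b => skew_mon (braid_action D) b (braid_lift w)) c.
have liftD : {morph lift : c d / c + d}.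
  by move=> c d; apply: malg_extD => w b b'; exact: skew_monD.
have liftU w b : lift << b *g w >> = skew_mon (braid_action D) b (braid_lift w).
  by apply: malg_extU => v b' b''; exact: skew_monD.
have combE c : marin_comb c = rq_class (@marin_rel W k D) (lift c).
  move: c; apply: eq_malg_morphD => [|c d|w b]; first exact: marin_combD.
    by rewrite liftD rmorphD.
  by rewrite marin_combU liftU marin_skew_mon.
have opE c : skew_op (lift c) << 1 *g 1%g >> = c.
  move: c; apply: eq_malg_morphD => [c d|//|w b].
    by rewrite liftD; exact: skew_op_Dl.
  rewrite liftU skew_op_U (braid_op_lift a_act).
  by apply: etrans (malg_lscaleU _ _ _) _; rewrite mulr1.
move=> c d; rewrite !combE => /rq_classP /(skew_op_ideal a_act << 1 *g 1%g >>).
move=> h; rewrite -(opE c) -(opE d); apply/eqP; rewrite -subr_eq0; apply/eqP.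
by rewrite -h; apply: esym (action_Bl (@skew_op_Dl _ _ _) _ _ _).
Qed.

(** * Spanning by the [g_w] *)

Definition marin_span (x : marin_ring D) := exists c, marin_comb c = x.

Lemma marin_spanD x y : marin_span x -> marin_span y -> marin_span (x + y).
Proof. by move=> [c <-] [d <-]; exists (c + d); rewrite marin_combD. Qed.

Lemma marin_span_lift w : marin_span (marin_braid D (braid_lift w)).
Proof. by exists << 1 *g w >>; rewrite marin_combU marin_in1 mul1r. Qed.

Lemma marin_span_scale b x : marin_span x -> marin_span (marin_in D b * x).
Proof.
move=> [c <-]; elim/malg_ind: c => [|w b'|c d IHc IHd].
- by rewrite (morphD0 marin_combD) mulr0; exists 0; rewrite (morphD0 marin_combD).
- by exists << b * b' *g w >>; rewrite !marin_combU marin_inM mulrA.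
- by rewrite marin_combD mulrDr; exact: marin_spanD.
Qed.

(** Coefficients move to the left of [g_s]. At a descent, Matsumoto's theorem allows a reduced word
    of [w] starting with [s], and the quadratic relation applies. At an ascent,
    [g_s g_w = g_(sw)]. *)
Lemma marin_span_gen s x :
  marin_span x -> marin_span (marin_braid D (braid_gen s) * x).
Proof.
move=> [c <-]; elim/malg_ind: c => [|w b'|c d IHc IHd]; last 1 first.
- by rewrite marin_combD mulrDr; exact: marin_spanD.
- by rewrite (morphD0 marin_combD) mulr0; exists 0; rewrite (morphD0 marin_combD).
rewrite marin_combU mulrA marin_braid_in -mulrA; apply: marin_span_scale.
case ws : (parity w (sgen s)).
  have [x' [x'E rx' rsx']] := reduced_descent ws.
  have -> : w = cox_prod (s :: x') by rewrite cox_prod_cons x'E mulgA sgenK mul1g.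
  rewrite braid_lift_reduced// braid_prod_cons marin_braidM mulrA marin_quadratic.
  rewrite mulrDl -mulrA -marin_braidM -braid_prod_cons -!braid_lift_reduced//.
  by apply: marin_spanD; apply: marin_span_scale; exact: marin_span_lift.
have -> : braid_lift w = braid_prod (reduced_expr w) by [].
rewrite -marin_braidM -braid_prod_cons -braid_lift_reduced; last exact: reduced_cons.
exact: marin_span_lift.
Qed.

Lemma marin_braid_genV s x :
  marin_braid D (pres_class (@braid_rel W) [:: (s, false)]) * x =
  marin_in D (a_inv D s) *
    (marin_braid D (braid_gen s) * x + marin_in D (a s - 1) * x).
Proof.
set V := marin_braid D _.
have VA b : act (sgen s) b = b -> V * marin_in D b = marin_in D b * V.
  move=> bE; rewrite /V marin_braid_in /braid_proj pres_lift_class.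
    by rewrite /word_eval big_seq1 /= sgenV bE.
  exact: braid_rel_eval.
apply: (@quadratic_inverse _ _ _ (marin_in D (a s)) (marin_in D (1 - a s))).
- rewrite /V -marin_braidM -pres_classM -marin_braid1; congr (marin_braid D _).
  exact/pres_classP/pres_cancel.
- exact: marin_quadratic.
- by rewrite -marin_inD -[a s - 1]opprB subrr marin_in0.
- exact/VA/act_a.
- exact/VA/act_1a.
- by rewrite -marin_inM mulrC mul_a_inv.
Qed.

Lemma marin_span_genV s x : marin_span x ->
  marin_span (marin_braid D (pres_class (@braid_rel W) [:: (s, false)]) * x).
Proof.
move=> sx; rewrite marin_braid_genV; apply: marin_span_scale.
apply: marin_spanD; [exact: marin_span_gen|exact: marin_span_scale].
Qed.

(** The class of a braid is built from [g_1 = 1] by left multiplication with generators and their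
    inverses, which preserve the span. *)
Lemma marin_span_all x : marin_span x.
Proof.
elim/marin_ind: x => [|b g|y z]; last exact: marin_spanD.
- by exists 0; rewrite (morphD0 marin_combD).
- apply: marin_span_scale; rewrite -(pres_reprK g).
  elim: (repr g) => [|[s eps] w IHw].
    have -> : pres_class (@braid_rel W) [::] = braid_lift 1%g.
      by rewrite -cox_prod_nil braid_lift_reduced ?/braid_prod ?big_nil.
    exact: marin_span_lift.
  rewrite -cat1s pres_classM marin_braidM; case: eps; first exact: marin_span_gen.
  exact: marin_span_genV.
Qed.

Lemma marin_basis : is_basis (fun w : W => marin_braid D (braid_lift w)).
Proof.
move=> x; have [c cx] := marin_span_all x; exists c; split=> [|d].
  by rewrite -cx.
by rewrite -cx => /marin_comb_inj.
Qed.
End MarinBasis.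

(** * Augmentation *)

Lemma additive_mul (S S' : pzRingType) (f : S -> S') (P : S -> Prop) :
  {morph f : x y / x + y} ->
  (forall Q : S -> Prop, Q 0 -> (forall x, P x -> Q x) ->
     (forall x y, Q x -> Q y -> Q (x + y)) -> forall x, Q x) ->
  (forall x y, P x -> P y -> f (x * y) = f x * f y) ->
  {morph f : x y / x * y}.
Proof.
move=> fD Pgen fM x y.
have f0 : f 0 = 0 by apply: (addIr (f 0)); rewrite -fD !add0r.
elim/Pgen: x => [|x Px|x x' IHx IHx'].
- by rewrite mul0r f0 mul0r.
- elim/Pgen: y => [|y Py|y y' IHy IHy'].
  + by rewrite mulr0 f0 mulr0.
  + exact: fM.
  + by rewrite mulrDr !fD mulrDr IHy IHy'.
- by rewrite mulrDl !fD mulrDl IHx IHx'.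
Qed.

Lemma ideal_gen_morph (S S' : pzRingType) (f : {rmorphism S -> S'})
    (X : set S) (X' : set S') : (forall x, X x -> X' (f x)) ->
  forall x, ideal_gen X x -> ideal_gen X' (f x).
Proof.
move=> fX x; elim=> {x} [x Xx||x y _ IHx _ IHy|b x _ IHx|x b _ IHx].
- exact/ideal_mem/fX.
- by rewrite rmorph0; exact: ideal_0.
- by rewrite rmorphD; exact: ideal_add.
- by rewrite rmorphM; exact: ideal_mull.
- by rewrite rmorphM; exact: ideal_mulr.
Qed.

Lemma rmorph_quadratic (S S' : pzRingType) (f : {rmorphism S -> S'}) g b c g' b' c' :
  f g = g' -> f b = b' -> f c = c' ->
  f (g ^+ 2 - b - c * g) = g' ^+ 2 - b' - c' * g'.
Proof. by move=> <- <- <-; rewrite !rmorphB rmorphXn rmorphM. Qed.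

Section QuotientMap.
Variables (S S' : pzRingType) (f : {rmorphism S -> S'}).
Variables (X : set S) (X' : set S').
Hypothesis fX : forall x, X x -> X' (f x).

Definition rq_map (q : ring_quot X) : ring_quot X' := rq_class X' (f (repr q)).

Lemma rq_map_class x : rq_map (rq_class X x) = rq_class X' (f x).
Proof.
apply/rq_classP; rewrite -rmorphB; apply: (ideal_gen_morph fX).
exact: rq_repr.
Qed.

Lemma rq_map_is_nmod : nmod_morphism rq_map.
Proof.
split=> [|p q]; first by rewrite -(rmorph0 (rq_class X)) rq_map_class !rmorph0.
rewrite -(rq_reprK p) -(rq_reprK q) -rmorphD !rq_map_class.
by rewrite rmorphD rmorphD.
Qed.

Lemma rq_map_is_monoid : GRing.monoid_morphism rq_map.
Proof.
split=> [|p q]; first by rewrite -(rmorph1 (rq_class X)) rq_map_class !rmorph1.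
rewrite -(rq_reprK p) -(rq_reprK q) -rmorphM !rq_map_class.
by rewrite rmorphM rmorphM.
Qed.
HB.instance Definition _ :=
  GRing.isNmodMorphism.Build (ring_quot X) (ring_quot X') rq_map rq_map_is_nmod.
HB.instance Definition _ :=
  GRing.isMonoidMorphism.Build (ring_quot X) (ring_quot X') rq_map rq_map_is_monoid.

Lemma ring_quot_map : exists psi : {rmorphism ring_quot X -> ring_quot X'},
  forall x, psi (rq_class X x) = rq_class X' (f x).
Proof. by exists rq_map; exact: rq_map_class. Qed.
End QuotientMap.

Section MarinMap.
Variables (W : coxeterSystem) (k : comPzRingType) (D D' : marin_datum W k).
Variable f : {rmorphism md_alg D -> md_alg D'}.
Hypothesis f_act : forall w b, f (md_act D w b) = md_act D' w (f b).
Hypothesis f_a : forall s, f (md_a D s) = md_a D' s.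

Definition skew_map (x : braid_skew D) : braid_skew D' :=
  malg_ext (fun g b => skew_mon (braid_action D') (f b) g) x.

Lemma skew_mapD : {morph skew_map : x y / x + y}.
Proof. by move=> x y; apply: malg_extD => g b c; rewrite rmorphD skew_monD. Qed.

Lemma skew_mapU b g :
  skew_map (skew_mon (braid_action D) b g) = skew_mon (braid_action D') (f b) g.
Proof. by apply: malg_extU => h c d; rewrite rmorphD skew_monD. Qed.

Lemma skew_map_is_nmod : nmod_morphism skew_map.
Proof. by split; [exact: malg_ext0|exact: skew_mapD]. Qed.

Lemma skew_map_is_monoid : GRing.monoid_morphism skew_map.
Proof.
split; first by rewrite -!skew_mon1 skew_mapU rmorph1.
apply: (additive_mul skew_mapD
  (P := fun x => exists b g, x = skew_mon (braid_action D) b g)) => [Q Q0 QU QD|].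
  by apply: malg_ind => // g b; apply: QU; exists b, g.
move=> _ _ [b [g ->]] [c [h ->]].
by rewrite skew_monM !skew_mapU skew_monM rmorphM f_act.
Qed.
HB.instance Definition _ := GRing.isNmodMorphism.Build
  (braid_skew D) (braid_skew D') skew_map skew_map_is_nmod.
HB.instance Definition _ := GRing.isMonoidMorphism.Build
  (braid_skew D) (braid_skew D') skew_map skew_map_is_monoid.

Lemma skew_map_rel x : @marin_rel W k D x -> @marin_rel W k D' (skew_map x).
Proof.
move=> [s ->]; exists s; apply: rmorph_quadratic.
- by apply: etrans (skew_mapU _ _) _; rewrite rmorph1.
- by apply: etrans (skew_mapU _ _) _; rewrite f_a.
- by apply: etrans (skew_mapU _ _) _; rewrite rmorphB rmorph1 f_a.
Qed.

(** An equivariant [f] respects the twisted product, and as it matches the parameters it sends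
    relators to relators. Surjectivity passes from [f] to [psi] because the elements [b' g] generate
    the target additively. *)
Lemma marin_map : exists psi : {rmorphism marin_ring D -> marin_ring D'},
  [/\ (forall c, f (md_scal D c) = md_scal D' c) ->
        forall c x, psi (marin_scal D c * x) = marin_scal D' c * psi x,
      forall b, psi (marin_in D b) = marin_in D' (f b),
      forall g, psi (marin_braid D g) = marin_braid D' g &
      (forall b', exists b, f b = b') -> forall y, exists x, psi x = y].
Proof.
have [psi psiE] := ring_quot_map skew_map_rel; exists psi.
have psi_in b : psi (marin_in D b) = marin_in D' (f b).
  exact: etrans (psiE _) (congr1 _ (skew_mapU _ _)).
have psi_inM b x : psi (marin_in D b * x) = marin_in D' (f b) * psi x.
  by rewrite rmorphM psi_in.
have psi_braid g : psi (marin_braid D g) = marin_braid D' g.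
  by apply: etrans (psiE _) (congr1 _ _); rewrite /= skew_mapU rmorph1.
split=> // [f_scal c x|f_surj]; first by rewrite psi_inM f_scal.
elim/marin_ind => [|b' g|y y' [x <-] [x' <-]].
- by exists 0; rewrite rmorph0.
- have [b <-] := f_surj b'; exists (marin_in D b * marin_braid D g).
  by rewrite psi_inM psi_braid.
- by exists (x + x'); rewrite rmorphD.
Qed.
End MarinMap.

Section Augmentation.
Variables (R : comPzRingType) (E : comMonoidType).

Lemma augmentationU (r : R) (x : E) : augmentation (malg_mon r x) = r.
Proof. exact: malg_extU. Qed.

Lemma augmentation_is_nmod : nmod_morphism (@augmentation R E).
Proof. by split=> [|f g]; [exact: malg_ext0|exact: malg_extD]. Qed.

Lemma augmentation_is_monoid : GRing.monoid_morphism (@augmentation R E).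
Proof.
split; first exact: augmentationU.
apply: (additive_mul augmentation_is_nmod.2
  (P := fun x => exists r y, x = malg_mon r y)) => [Q Q0 QU QD|].
  by apply: malg_ind => // y r; apply: QU; exists r, y.
by move=> _ _ [r [x ->]] [s [y ->]]; rewrite malg_monM !augmentationU.
Qed.
HB.instance Definition _ := GRing.isNmodMorphism.Build
  (monoid_alg R E) R (@augmentation R E) augmentation_is_nmod.
HB.instance Definition _ := GRing.isMonoidMorphism.Build
  (monoid_alg R E) R (@augmentation R E) augmentation_is_monoid.

Variables (G : monoidType) (rho : monoid_action G E).

(** The action moves monoid elements and keeps their coefficients. *)
Lemma augmentation_act g (f : monoid_alg R E) :
  augmentation (lin_act rho g f) = augmentation f.
Proof.
move: f; apply: eq_malg_morphD => [f f'|f f'|x r].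
- by rewrite lin_actD; exact: (raddfD (@augmentation R E)).
- exact: (raddfD (@augmentation R E)).
- by rewrite -/(malg_mon r x) lin_actU !augmentationU.
Qed.
End Augmentation.

Lemma augmentation_e_hat (W : coxeterSystem) (E : comMonoidType) (e : simple W -> E)
    (R : comPzRingType) (u : simple W -> R) s : augmentation (e_hat e u s) = u s.
Proof.
rewrite /e_hat rmorphD rmorph1 rmorphM /= !augmentationU mulr1.
by rewrite addrC subrK.
Qed.

(** Since [1 - e_hat] is [-(u_s - 1) e_s], the claim reduces by linearity to the monoid condition on
    single elements. *)
Lemma e_hat_absorb (W : coxeterSystem) (E : comMonoidType) (rho : monoid_action W E)
    (e : simple W -> E) (R : comPzRingType) (u : simple W -> R) :
  (forall s x, (e s * x)%g = (e s * rho (sgen s) x)%g) ->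
  forall s f, (1 - e_hat e u s) * f =
    (1 - e_hat e u s) * lin_action R rho (sgen s) f.
Proof.
move=> absorb s f; rewrite /e_hat opprD addrA subrr add0r -mulNr -!mulrA.
congr (_ * _); move: f; apply: eq_malg_morphD => [f g|f g|x r].
- exact: mulrDr.
- by rewrite ract_add; exact: mulrDr.
- rewrite -/(malg_mon r x) /= lin_actU /malg_elt.
  by rewrite !malg_monM absorb.
Qed.

Lemma orbit_gen_absorb (W : coxeterSystem) (M : comMonoidType)
    (rho : monoid_action W M) (e : simple W -> M) s :
  (forall t w, (e s * rho w (e t))%g = (e s * rho (sgen s) (rho w (e t)))%g) ->
  forall x, orbit_gen rho e x -> (e s * x)%g = (e s * rho (sgen s) x)%g.
Proof.
move=> absorb x; elim=> {x} [w t||x y _ IHx _ IHy]; first exact: absorb.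
  by rewrite mact_one.
(* Once the factor [x] is settled, commutativity brings [e s] next to [y]. *)
by rewrite mact_mul !mulgA -IHx [(e s * x)%g]Defs.commgC -!mulgA IHy.
Qed.

Lemma juyumaya_MIH (K : realType) (W U : coxeterSystem)
    (phi : {multiplicative W -> U}) (e : simple W -> root_subsystem K U) :
  is_juyumaya phi e -> is_MIH_monoid (Sigma_e_action phi e) (Sigma_e_map phi e).
Proof.
move=> J; split=> [s||s x].
- exact: Sigma_e_idem.
- exact: Sigma_e_equiv.
- apply: val_inj; have /asboolP := valP x.
  (* On a generator [w.e_t] the two products are the generated subsystems equated by the second
     Juyumaya condition. *)
  apply: orbit_gen_absorb => t w; apply: val_inj.
  by rewrite -mactM; exact: J.2.
Qed.

Theorem theorem1p1 (K : realType) (W U : coxeterSystem)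
    (phi : {multiplicative W -> U}) (e : simple W -> root_subsystem K U)
    (J : is_juyumaya phi e)
    (R : comPzRingType) (u : simple W -> R)
    (u_unit : forall s, invertible (u s))
    (u_equiv : equivariant (fun _ (r : R) => r) u) :
  let D := juyumaya_datum J u_unit u_equiv in
  let H := hecke_datum u_unit u_equiv in
  [/\ is_MIH_monoid (Sigma_e_action phi e) (Sigma_e_map phi e),
      is_basis (fun w : W => marin_braid D (braid_lift w)) &
      exists psi : {rmorphism marin_ring D -> marin_ring H},
        [/\ forall (c : R) x, psi (marin_scal D c * x) = marin_scal H c * psi x,
            forall f : monoid_alg R (Sigma_e phi e),
              psi (marin_in D f) = marin_in H (augmentation f),
            forall s, psi (marin_braid D (braid_gen s)) =
              marin_braid H (braid_gen s) &
            forall y, exists x, psi x = y]].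
Proof.
move=> D H; have MIH := juyumaya_MIH J; split=> //.
  (* The absorption hypothesis of the basis theorem is the third Marin condition carried to the
     monoid algebra. *)
  by apply: marin_basis => s b; case: MIH => _ _ absorb; exact: e_hat_absorb.
have [psi [psi_scal psi_in psi_braid psi_surj]] :=
  @marin_map W R D H (@augmentation R (Sigma_e phi e))
    (augmentation_act (Sigma_e_action phi e)) (augmentation_e_hat _ _).
exists psi; split=> //.
  by apply: psi_scal => c; exact: augmentationU.
by apply: psi_surj => r; exists (malg_scal _ r); exact: augmentationU.
Qed.
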